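(* Let $\rho$ be the branching number (with respect to the number of vertices placed into the cover) of an exact branching algorithm for $k$-vertex cover; in particular one may take $\rho = 1.4656$. Given a Vertex Cover instance consisting of a graph $G$ on $n$ vertices, a number $k < n/\rho$, and an $\varepsilon > 0$ with the guarantee that $G$ has at least $\varepsilon \binom{n}{k}$ vertex covers of size $k$, one can find such a vertex cover in deterministic time $$O^*\left(\varepsilon^{-\frac{\log \rho}{\log(\frac{n}{\rho k})}}\right).$$
   Context: A vertex cover of size $k$ of a graph $G$ is a set $S$ of $k$ vertices such that every edge of $G$ has at least one endpoint in $S$. For a branching algorithm for vertex cover that, at each branching, produces subproblems in which $d_1,\ldots,d_t$ vertices respectively are added to the partial cover, the branching number $\rho$ is the largest, over all branchings, of the smallest positive solution $x$ of $\sum_i x^{-d_i} = 1$. (For example, the algorithm that branches on a vertex $v$ of degree at least $3$ into ''$v$ in the cover'' and ''all neighbors of $v$ in the cover'', and solves maximum-degree-$2$ instances in polynomial time, has $\rho < 1.4656$.) Logarithms are base $2$, and $O^*(\cdot)$ suppresses factors polynomial in $n$. *)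

(* Defs.v *)
From HB Require Import structures.
From mathcomp Require Import all_boot all_order all_algebra.
From mathcomp Require Import reals exp.

Set Implicit Arguments.
Unset Strict Implicit.
Unset Printing Implicit Defensive.

Import Order.TTheory GRing.Theory Num.Theory.

(** ** Vertex covers *)

Record sgraph (n : nat) := SGraph {
  adj :> rel 'I_n;
  adj_sym : symmetric adj;
  adj_irr : irreflexive adj }.

Definition vertex_cover n (G : sgraph n) (S : {set 'I_n}) : bool :=
  [forall i, forall j, G i j ==> (i \in S) || (j \in S)].

Definition vertex_covers n (G : sgraph n) (k : nat) : {set {set 'I_n}} :=
  [set S : {set 'I_n} | vertex_cover G S & #|S| == k].

(** ** Model of computation

  A program is a finite list of mutually recursive first-order functions over
  binary trees (S-expressions), each with a single argument, together with a
  main expression. Evaluation is call-by-value, and every evaluation step has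
  unit cost. Trees can be represented by pointers, without copying, so each step
  takes constant time on a pointer machine or RAM; conversely, such machines are
  simulated with an overhead polylogarithmic in the running time. That overhead
  is polynomial in [n] for running times up to [2 ^ poly(n)], so bounds that
  suppress polynomial factors do not depend on the choice of model. *)

Inductive tree := Nil | Cons of tree & tree.

Inductive expr :=
  | EArg
  | ENil
  | ECons of expr & expr
  | EHd of expr
  | ETl of expr
  | EIf of expr & expr & expr
  | ECall of nat & expr.

Record program := Program { funs : seq expr; main : expr }.

Definition hd_tree (v : tree) := if v is Cons a _ then a else Nil.
Definition tl_tree (v : tree) := if v is Cons _ b then b else Nil.

(* [eval F x e v t]: with function bodies [F] and argument [x], the expression
   [e] evaluates to [v] in exactly [t] steps. *)
Inductive eval (F : seq expr) : tree -> expr -> tree -> nat -> Prop :=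
  | EvArg x : eval F x EArg x 1
  | EvNil x : eval F x ENil Nil 1
  | EvCons x a b u v s t :
      eval F x a u s -> eval F x b v t ->
      eval F x (ECons a b) (Cons u v) (s + t).+1
  | EvHd x a u s : eval F x a u s -> eval F x (EHd a) (hd_tree u) s.+1
  | EvTl x a u s : eval F x a u s -> eval F x (ETl a) (tl_tree u) s.+1
  | EvIfT x c a b u1 u2 v s t :
      eval F x c (Cons u1 u2) s -> eval F x a v t ->
      eval F x (EIf c a b) v (s + t).+1
  | EvIfF x c a b v s t :
      eval F x c Nil s -> eval F x b v t ->
      eval F x (EIf c a b) v (s + t).+1
  | EvCall x f a u v s t :
      eval F x a u s -> eval F u (nth ENil F f) v t ->
      eval F x (ECall f a) v (s + t).+1.

Definition runs (P : program) (input output : tree) (t : nat) : Prop :=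
  eval (funs P) input (main P) output t.

Lemma eval_det F x e v t v' t' :
  eval F x e v t -> eval F x e v' t' -> v = v' /\ t = t'.
Proof.
move=> ev; elim: ev v' t' => {x e v t}; intros;
  match goal with H : eval _ _ _ ?v' ?t' |- _ = ?v' /\ _ = ?t' =>
    inversion H; subst end => //;
  repeat match goal with
  | IH : forall v t, eval ?F ?x ?e v t -> _, H : eval ?F ?x ?e _ _ |- _ =>
    case: (IH _ _ H) => ? ?; clear IH; subst
  end => //; congruence.
Qed.

(** ** Encodings

  Numbers are in unary; the only ones encoded are at most [n]. *)

Definition enc_seq (s : seq tree) : tree := foldr Cons Nil s.

Definition enc_bool (b : bool) : tree := if b then Cons Nil Nil else Nil.

Definition enc_nat (m : nat) : tree := enc_seq (nseq m Nil).

Definition enc_set n (S : {set 'I_n}) : tree :=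
  enc_seq [seq enc_bool (i \in S) | i <- enum 'I_n].

Definition enc_graph n (G : sgraph n) : tree :=
  enc_seq [seq enc_seq [seq enc_bool (G i j) | j <- enum 'I_n]
          | i <- enum 'I_n].

Definition enc_instance n (G : sgraph n) (k : nat) : tree :=
  Cons (enc_graph G) (enc_nat k).

Definition enc_subproblem n (G : sgraph n) (k : nat) (S : {set 'I_n}) : tree :=
  Cons (enc_instance G k) (enc_set S).

(** ** Branching algorithms

  The subproblem [(G, k, S)] asks for a vertex cover of size [k] that contains
  the partial cover [S]. A branching algorithm either solves it outright or
  returns the vertex sets that the resulting subproblems add to [S]. *)

Inductive outcome (n : nat) :=
  | Solved of option {set 'I_n}
  | Branch of seq {set 'I_n}.

Definition enc_outcome n (o : outcome n) : tree :=
  match o with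
  | Solved None => Nil
  | Solved (Some C) => Cons Nil (enc_set C)
  | Branch Ds => Cons (Cons Nil Nil) (enc_seq [seq enc_set D | D <- Ds])
  end.

(* A branching is exhaustive: every solution of the subproblem is a solution of
   one of the subproblems it produces. *)
Definition correct_outcome n (G : sgraph n) (k : nat) (S : {set 'I_n})
    (o : outcome n) : Prop :=
  match o with
  | Solved None => forall T, T \in vertex_covers G k -> ~~ (S \subset T)
  | Solved (Some C) => C \in vertex_covers G k /\ S \subset C
  | Branch Ds =>
      [/\ Ds != [::],
          forall D, D \in Ds -> D != set0 /\ [disjoint D & S]
        & forall T, T \in vertex_covers G k -> S \subset T ->
            exists2 D, D \in Ds & D \subset T]
  end.

Definition step_function :=
  forall n : nat, sgraph n -> nat -> {set 'I_n} -> outcome n.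

(* The partial covers at the nodes of the branching tree. *)
Inductive subproblem (step : step_function) n (G : sgraph n) (k : nat) :
    {set 'I_n} -> Prop :=
  | SubRoot : subproblem step G k set0
  | SubBranch S Ds D :
      subproblem step G k S -> step n G k S = Branch Ds -> D \in Ds ->
      subproblem step G k (S :|: D).

Record branching_algorithm := BranchingAlgorithm {
  step : step_function;
  step_correct : forall n (G : sgraph n) k S, k <= n ->
    subproblem step G k S -> correct_outcome G k S (step G k S);
  step_code : program;
  step_polytime : exists p : {poly nat},
    forall n (G : sgraph n) k S, k <= n -> subproblem step G k S ->
    exists2 t, t <= p.[n]%R
             & runs step_code (enc_subproblem G k S)
                              (enc_outcome (step G k S)) t }.

(* [ds] lists the numbers of vertices added in some branching of [A]. *)
Definition branching_vector (A : branching_algorithm) (ds : seq nat) : Prop :=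
  exists n (G : sgraph n) k S Ds,
    [/\ k <= n, subproblem (step A) G k S, step A G k S = Branch Ds
      & ds = [seq #|D| | D : {set 'I_n} <- Ds]].

Local Open Scope ring_scope.

Definition vector_value (R : realType) (ds : seq nat) (x : R) : Prop :=
  let solution y := 0 < y /\ \sum_(d <- ds) y ^- d = 1 in
  solution x /\ forall y, solution y -> x <= y.

Definition branching_number (R : realType) (A : branching_algorithm) (rho : R)
    : Prop :=
  (exists2 ds, branching_vector A ds & vector_value ds rho) /\
  (forall ds x, branching_vector A ds -> vector_value ds x -> x <= rho).

(** ** Finding a vertex cover when there are many *)

Definition log2 (R : realType) (x : R) : R := ln x / ln 2.

(* [k = 0] is allowed: there the exponent, which tends to [0] as [k] does, is
   [0] because [x / 0 = 0] and [ln 0 = 0].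

   The program is not told [eps]: a fortiori a program may receive [eps] in any
   representation, and ignore it. *)
Definition finds_cover_among_many (R : realType) (rho : R) : Prop :=
  exists (Q : program) (p : {poly nat}),
  forall (n : nat) (G : sgraph n) (k : nat) (eps : R),
    k%:R < n%:R / rho ->
    0 < eps ->
    eps * ('C(n, k))%:R <= (#|vertex_covers G k|)%:R ->
    exists (C : {set 'I_n}) (t : nat),
      [/\ C \in vertex_covers G k,
          runs Q (enc_instance G k) (enc_set C) t
        & t%:R <= (p.[n])%:R *
                  eps `^ (- (log2 rho / log2 (n%:R / (rho * k%:R))))].

(* Main.v *)
(* A node of the branching tree with partial cover [S] gets the weight
   [rho ^- #|S|]; as [rho] is the branching number, the weights of the children
   add up to at most the weight of the parent. So at most [rho ^ j] nodes have
   [#|S| = j], and the nodes with [#|S| <= l] are searched in time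
   [O*(rho ^ l)]. At most [(k / n) ^ #|S|] of all [k]-sets contain [S], so if no
   node with [#|S| < l] yields a cover, then the nodes at which the search stops
   account for at most a fraction [(rho * k / n) ^ l] of all [k]-sets, and
   [eps <= (rho * k / n) ^ l]. Iterative deepening therefore stops at some [l] with
   [rho ^ l <= eps ^ (- log rho / log (n / (rho * k)))].

   For 1.4656, branch on a vertex with at least three neighbours outside [S]. If
   there is none, extend [S] greedily, preferring neighbours of leaves, to a
   minimum cover above [S], and pad it to size [k]. *)

Require Import Defs.
From HB Require Import structures.
From mathcomp Require Import all_boot all_order all_algebra.
From mathcomp Require Import reals exp.
From mathcomp Require Import zify lra.
Set Implicit Arguments.
Unset Strict Implicit.
Unset Printing Implicit Defensive.
Import Order.TTheory GRing.Theory Num.Theory.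
(* [seq] shadows the constructors [Nil] and [Cons] of [tree]. *)
Import Defs.

(** * Running times *)

(** The analysis never uses that [rho] is attained by some branching, only [1 <= rho] and the weight
    inequality. It is therefore carried out for any such [rho]: 1.4656 is not the branching number
    but lies just above 1.46557..., the root of [x^3 = x^2 + 1] that belongs to the branching (1,
    3).

    The weights count only the nodes with at most [l] vertices. Larger children are also generated,
    tested and discarded, so the number of children of a node must be polynomial, although nothing
    in the definition of a branching says so. It follows from the running time of the step program:
    [t] steps deepen a tree by at most [t] levels, and a list is at least as deep as it is long.
    Depth is the right measure because sharing lets the size of a tree grow exponentially in the
    number of steps. *)

Definition ev F x e v T := exists2 t, t <= T & eval F x e v t.

(** With upper bounds in place of exact costs, the cost of an expression can stay an existential
    variable while its evaluation is built, and be compared with a closed formula at the end. *)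
Lemma ev_le F x e v T T' : ev F x e v T -> T <= T' -> ev F x e v T'.
Proof. by case=> t tT evt TT'; exists t => //; apply: leq_trans TT'. Qed.

Lemma ev_arg F x : ev F x EArg x 1.
Proof. by exists 1 => //; constructor. Qed.

Lemma ev_nil F x : ev F x ENil Nil 1.
Proof. by exists 1 => //; constructor. Qed.

Lemma ev_cons F x a b u v s t :
  ev F x a u s -> ev F x b v t -> ev F x (ECons a b) (Cons u v) (s + t).+1.
Proof.
move=> [s' ss' ea] [t' tt' eb]; exists (s' + t').+1; first by rewrite ltnS leq_add.
by constructor.
Qed.

Lemma ev_hd F x a u w s : ev F x a (Cons u w) s -> ev F x (EHd a) u s.+1.
Proof. by case=> s' ss' ea; exists s'.+1 => //; apply: (EvHd ea). Qed.

Lemma ev_tl F x a u w s : ev F x a (Cons u w) s -> ev F x (ETl a) w s.+1.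
Proof. by case=> s' ss' ea; exists s'.+1 => //; apply: (EvTl ea). Qed.

Lemma ev_ifT F x c a b u1 u2 v s t :
  ev F x c (Cons u1 u2) s -> ev F x a v t -> ev F x (EIf c a b) v (s + t).+1.
Proof.
move=> [s' ss' ec] [t' tt' ea]; exists (s' + t').+1; first by rewrite ltnS leq_add.
exact: EvIfT ec ea.
Qed.

Lemma ev_ifF F x c a b v s t :
  ev F x c Nil s -> ev F x b v t -> ev F x (EIf c a b) v (s + t).+1.
Proof.
move=> [s' ss' ec] [t' tt' ea]; exists (s' + t').+1; first by rewrite ltnS leq_add.
exact: EvIfF ec ea.
Qed.

Lemma ev_if_nat F x c a b m v s t :
  ev F x c (enc_nat m) s -> ev F x (if m is 0 then b else a) v t ->
  ev F x (EIf c a b) v (s + t).+1.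
Proof. by case: m => [|m]; [apply: ev_ifF | apply: ev_ifT]. Qed.

Lemma ev_if_bool F x c a b (z : bool) v s t :
  ev F x c (enc_bool z) s -> ev F x (if z then a else b) v t ->
  ev F x (EIf c a b) v (s + t).+1.
Proof. by case: z; [apply: ev_ifT | apply: ev_ifF]. Qed.

Lemma ev_call F x f a u v s t :
  ev F x a u s -> ev F u (nth ENil F f) v t -> ev F x (ECall f a) v (s + t).+1.
Proof.
move=> [s' ss' ea] [t' tt' eb]; exists (s' + t').+1; first by rewrite ltnS leq_add.
exact: EvCall ea eb.
Qed.

Fixpoint depth t := if t is Cons a b then (maxn (depth a) (depth b)).+1 else 0.

(** Only [ECons] deepens a tree, by one level per step; a call passes on an argument that is already
    bounded in this way. *)
Lemma eval_depth F x e v t : eval F x e v t -> depth v <= depth x + t.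
Proof.
elim=> {x e v t} /=; try (intros; lia).
- move=> x a [|u w] /= s _; lia.
- move=> x a [|u w] /= s _; lia.
Qed.

Lemma size_le_depth (s : seq tree) : size s <= depth (enc_seq s).
Proof. by elim: s => //= x s IH; rewrite ltnS (leq_trans IH) ?leq_maxr. Qed.

Lemma depth_enc_seq d T (f : T -> tree) (e : seq T) :
  (forall i, depth (f i) <= d) ->
  depth (enc_seq [seq f i | i <- e]) <= d + size e.
Proof.
move=> fd; elim: e => // i e; rewrite /= -/(enc_seq _); have := fd i; lia.
Qed.

(** Functions are called by position, so placing a program behind [d] other functions shifts its
    calls by [d]. *)
Fixpoint relocate (d : nat) (e : expr) : expr :=
  match e with
  | EArg => EArg
  | ENil => ENil
  | ECons a b => ECons (relocate d a) (relocate d b)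
  | EHd a => EHd (relocate d a)
  | ETl a => ETl (relocate d a)
  | EIf c a b => EIf (relocate d c) (relocate d a) (relocate d b)
  | ECall f a => ECall (d + f) (relocate d a)
  end.

Lemma eval_relocate L F x e v t :
  eval F x e v t ->
  eval (L ++ [seq relocate (size L) b | b <- F]) x (relocate (size L) e) v t.
Proof.
elim=> {x e v t} /=; intros; try by econstructor; eauto.
apply: EvCall; first by eauto.
rewrite nth_cat ltnNge leq_addr /= addKn.
have [fF|Ff] := ltnP f (size F); first by rewrite (nth_map ENil).
(* A call to a missing function means [ENil]. The relocated functions come last in the list, so such
   a call stays out of range. *)
by rewrite nth_default ?size_map //; move: H2; rewrite nth_default.
Qed.

(** [enc_set] is the case [e = enum 'I_n]; an arbitrary [e] allows induction on the list. *)
Definition bits {T : Type} (p : pred T) (e : seq T) : tree :=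
  enc_seq [seq enc_bool (p i) | i <- e].

(* Conditionals are left to the caller, who knows which branch is taken. *)
Ltac ev_step :=
  match goal with
  | |- ev _ _ EArg _ _ => exact: ev_arg
  | |- ev _ _ ENil _ _ => exact: ev_nil
  | |- ev _ _ (ECons _ _) _ _ => eapply ev_cons
  | |- ev _ _ (EHd _) _ _ => eapply ev_hd
  | |- ev _ _ (ETl _) _ _ => eapply ev_tl
  | |- ev _ _ (ECall _ _) _ _ => eapply ev_call
  | |- ev _ _ (nth _ _ _) _ _ => solve [eauto with prog]
  end.

(** * A library of programs on characteristic vectors *)

Notation ETrue := (ECons ENil ENil).
Notation x1 := (EHd EArg).
Notation x2 := (ETl EArg).

Definition count_body :=
  EIf EArg (EIf x1 (ECons ENil (ECall 0 x2)) (ECall 0 x2)) ENil.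
(* [Cons Nil (a - b)] if [b <= a], else [Nil] *)
Definition sub_body :=
  EIf x2 (EIf x1 (ECall 1 (ECons (ETl x1) (ETl x2))) ENil) (ECons ENil x1).
Definition union_body :=
  EIf x1 (ECons (EIf (EHd x1) ETrue (EHd x2)) (ECall 2 (ECons (ETl x1) (ETl x2))))
    ENil.
Definition diff_body :=
  EIf x1 (ECons (EIf (EHd x2) ENil (EHd x1)) (ECall 3 (ECons (ETl x1) (ETl x2))))
    ENil.
Definition clear_body := EIf EArg (ECons ENil (ECall 4 x2)) ENil.
Definition first_body :=
  EIf EArg (EIf x1 (ECons ETrue (ECall 4 x2)) (ECons ENil (ECall 5 x2))) ENil.
Definition fill_body :=
  EIf x1
    (EIf (EHd x1) (ECons ETrue (ECall 6 (ECons (ETl x1) x2)))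
       (EIf x2 (ECons ETrue (ECall 6 (ECons (ETl x1) (ETl x2))))
          (ECons ENil (ECall 6 (ECons (ETl x1) x2)))))
    ENil.
(* rows meeting a set *)
Definition nbrs_body :=
  EIf x1
    (ECons
       (EIf (ECall 0 (ECall 3 (ECons (EHd x1) (ECall 3 (ECons (EHd x1) x2)))))
          ETrue ENil)
       (ECall 7 (ECons (ETl x1) x2)))
    ENil.
(* rows with at least a given number of elements outside a set *)
Definition degge_body :=
  EIf x1
    (ECons
       (EIf (ECall 1 (ECons (ECall 0 (ECall 3 (ECons (EHd x1) (EHd x2)))) (ETl x2)))
          ETrue ENil)
       (ECall 8 (ECons (ETl x1) x2)))
    ENil.

Definition set_lib :=
  [:: count_body; sub_body; union_body; diff_body; clear_body; first_body;
      fill_body; nbrs_body; degge_body].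

(** The library always heads the function list, so its indices 0 to 8 stay valid whatever functions
    [X] follow. *)
Notation computes X f u v T :=
  (ev (set_lib ++ X) u (nth ENil (set_lib ++ X) f) v T).

Lemma nth_lib X i : i < 9 -> nth ENil (set_lib ++ X) i = nth ENil set_lib i.
Proof. by move=> i9; rewrite nth_cat i9. Qed.

Lemma bits_cons T (p : pred T) i e :
  bits p (i :: e) = Cons (enc_bool (p i)) (bits p e).
Proof. by []. Qed.

Lemma enc_seq_cons x s : enc_seq (x :: s) = Cons x (enc_seq s).
Proof. by []. Qed.

Lemma enc_natS m : enc_nat m.+1 = Cons Nil (enc_nat m).
Proof. by []. Qed.

Lemma ev_count_seq X T (p : pred T) e :
  computes X 0 (bits p e) (enc_nat (count p e)) (10 * size e + 10).
Proof.
elim: e => [|i e IH]; apply: ev_le.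
- by rewrite nth_lib //; apply: ev_ifF; repeat ev_step.
- by [].
- rewrite nth_lib //=; apply: ev_ifT; first exact: ev_arg.
  rewrite bits_cons; apply: ev_if_bool; first by repeat ev_step.
  (* One bound has to serve both branches, so it is fixed before the case split. *)
  instantiate (1 := (10 * size e + 10) + 5).
  case: (p i); rewrite ?add1n ?add0n ?enc_natS;
   (apply: ev_le; [ by repeat ev_step; apply: IH | lia]).
- rewrite /=; lia.
Qed.

Lemma ev_sub X a b :
  computes X 1 (Cons (enc_nat a) (enc_nat b))
    (if b <= a then Cons Nil (enc_nat (a - b)) else Nil) (20 * b + 10).
Proof.
elim: b a => [|b IH] a; apply: ev_le.
- rewrite nth_lib //= subn0; apply: ev_ifF; first by repeat ev_step.
  by repeat ev_step.
- by [].
- rewrite nth_lib // enc_natS; apply: ev_ifT; first by repeat ev_step.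
  apply: (@ev_if_nat _ _ _ _ _ a); first by repeat ev_step.
  instantiate (1 := 20 * b + 20).
  case: a => [|a] /=; first by apply: (ev_le (ev_nil _ _)); lia.
  rewrite subSS ltnS enc_natS; apply: ev_le; first by repeat ev_step; apply: IH.
  by lia.
- rewrite /=; lia.
Qed.

Lemma ev_union_seq X T (p q : pred T) e :
  computes X 2 (Cons (bits p e) (bits q e)) (bits (fun i => p i || q i) e)
    (30 * size e + 10).
Proof.
elim: e => [|i e IH]; apply: ev_le.
- by rewrite nth_lib //; apply: ev_ifF; repeat ev_step.
- by [].
- rewrite nth_lib // !bits_cons; apply: ev_ifT; first by repeat ev_step.
  repeat ev_step; last by apply: IH.
  apply: ev_if_bool; first by repeat ev_step.
  by instantiate (1 := 5); case: (p i) => /=; apply: ev_le; repeat ev_step.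
- rewrite /=; lia.
Qed.

Lemma ev_diff_seq X T (p q : pred T) e :
  computes X 3 (Cons (bits p e) (bits q e)) (bits (fun i => p i && ~~ q i) e)
    (30 * size e + 10).
Proof.
elim: e => [|i e IH]; apply: ev_le.
- by rewrite nth_lib //; apply: ev_ifF; repeat ev_step.
- by [].
- rewrite nth_lib // !bits_cons; apply: ev_ifT; first by repeat ev_step.
  repeat ev_step; last by apply: IH.
  apply: ev_if_bool; first by repeat ev_step.
  by instantiate (1 := 5); case: (q i); rewrite ?andbF ?andbT /=;
     apply: ev_le; repeat ev_step.
- rewrite /=; lia.
Qed.

Lemma ev_clear_seq X T (s : seq tree) (e : seq T) :
  size s = size e ->
  computes X 4 (enc_seq s) (bits pred0 e) (10 * size e + 10).
Proof.
elim: e s => [|i e IH] [|x s] // => [_|[se]]; apply: ev_le.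
- by rewrite nth_lib //; apply: ev_ifF; repeat ev_step.
- by [].
- rewrite nth_lib // bits_cons enc_seq_cons.
  apply: ev_ifT; first by repeat ev_step.
  by repeat ev_step; apply: IH.
- rewrite /=; lia.
Qed.

Lemma ev_first_seq X (T : eqType) (p : pred T) (e : seq T) :
  uniq e ->
  computes X 5 (bits p e) (bits [in take 1 [seq i <- e | p i]] e)
    (20 * size e + 20).
Proof.
elim: e => [_|i e IH]; first apply: ev_le.
- by rewrite nth_lib //; apply: ev_ifF; repeat ev_step.
- by [].
case/andP=> ie ue; apply: ev_le.
- rewrite nth_lib // !bits_cons [filter _ _]/=.
  apply: ev_ifT; first by repeat ev_step.
  apply: ev_if_bool; first by repeat ev_step.
  instantiate (1 := 20 * size e + 30).
  case: (p i) => /=; apply: ev_le.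
  + rewrite take0 mem_seq1 eqxx; ev_step; first by repeat ev_step.
    repeat ev_step.
    have -> : bits [in [:: i]] e = bits pred0 e.
      congr enc_seq; apply/eq_in_map => j je /=; rewrite mem_seq1.
      by case: eqP => // ji; rewrite -ji je in ie.
    by apply: ev_clear_seq; rewrite size_map.
  + lia.
  + rewrite (negbTE (_ : i \notin take 1 _)); last first.
      by apply: contra ie => /mem_take; rewrite mem_filter => /andP[].
    by repeat ev_step; apply: IH.
  + lia.
- rewrite /=; lia.
Qed.

Lemma ev_fill_seq X (T : eqType) (p : pred T) (e : seq T) m :
  uniq e ->
  computes X 6 (Cons (bits p e) (enc_nat m))
    (bits (fun i => p i || (i \in take m [seq i <- e | ~~ p i])) e)
    (30 * size e + 10).
Proof.
elim: e m => [m _|i e IH m]; first apply: ev_le.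
- by rewrite nth_lib //; apply: ev_ifF; repeat ev_step.
- by [].
case/andP=> ie ue; apply: ev_le.
- rewrite nth_lib // !bits_cons [filter _ _]/=.
  apply: ev_ifT; first by repeat ev_step.
  apply: ev_if_bool; first by repeat ev_step.
  instantiate (1 := 30 * size e + 33).
  case: (p i) => /=; apply: ev_le.
  + ev_step; first by repeat ev_step.
    by repeat ev_step; apply: IH.
  + lia.
  + apply: ev_if_nat; first by repeat ev_step.
    instantiate (1 := 30 * size e + 25).
    case: m => [|m] /=; apply: ev_le.
    * by have := IH 0 ue; rewrite take0 => ?; repeat ev_step; eauto.
    * lia.
    * rewrite mem_head.
      have -> : bits (fun j => p j || (j \in i :: take m [seq i <- e | ~~ p i])) e
        = bits (fun j => p j || (j \in take m [seq i <- e | ~~ p i])) e.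
        congr enc_seq; apply/eq_in_map => j je /=; rewrite in_cons.
        by case: eqP => // ji; rewrite -ji je in ie.
      by rewrite enc_natS; repeat ev_step; apply: IH.
    * lia.
  + lia.
- rewrite /=; lia.
Qed.

(** * Programs on vertex sets *)

(** A condition holds unless it is [Nil], and a unary number is [Nil] only if it is 0: counting the
    elements serves as the test for emptiness. *)
Lemma ev_if_set F x c a b (T : finType) (A : {set T}) v s t :
  ev F x c (enc_nat #|A|) s -> ev F x (if A == set0 then b else a) v t ->
  ev F x (EIf c a b) v (s + t).+1.
Proof.
move=> evc eva; apply: ev_if_nat evc _; move: eva; rewrite -cards_eq0.
by case: #|A|.
Qed.

Lemma eq_enc_set n (A : {set 'I_n}) (p : pred 'I_n) :
  p =1 [in A] -> bits p (enum 'I_n) = enc_set A.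
Proof. by move=> pA; congr enc_seq; apply: eq_map => i; rewrite pA. Qed.

Definition nbhd n (G : sgraph n) (v : 'I_n) : {set 'I_n} := [set w | G v w].

Definition first_set (T : finType) (A : {set T}) : {set T} :=
  [set x in take 1 (enum A)].

Definition fill_set (T : finType) (A : {set T}) (m : nat) : {set T} :=
  A :|: [set x in take m (enum (~: A))].

Lemma enum_filter (T : finType) (A : {set T}) :
  enum A = [seq x <- enum T | x \in A].
Proof. by rewrite [in RHS]enumT. Qed.

Section SetPrograms.

Variables (X : seq expr) (n : nat).
Implicit Types A B S : {set 'I_n}.

Lemma ev_count A : computes X 0 (enc_set A) (enc_nat #|A|) (10 * n + 10).
Proof.
have := ev_count_seq X [in A] (enum 'I_n).
by rewrite size_enum_ord cardE enum_filter size_filter.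
Qed.

Lemma ev_union A B :
  computes X 2 (Cons (enc_set A) (enc_set B)) (enc_set (A :|: B)) (30 * n + 10).
Proof.
have := ev_union_seq X [in A] [in B] (enum 'I_n).
rewrite size_enum_ord (@eq_enc_set _ (A :|: B)
  (fun i => (i \in A) || (i \in B))) // => i.
by rewrite /= inE.
Qed.

Lemma ev_diff A B :
  computes X 3 (Cons (enc_set A) (enc_set B)) (enc_set (A :\: B)) (30 * n + 10).
Proof.
have := ev_diff_seq X [in A] [in B] (enum 'I_n).
rewrite size_enum_ord (@eq_enc_set _ (A :\: B)
  (fun i => (i \in A) && (i \notin B))) // => i.
by rewrite /= inE andbC.
Qed.

(** A graph is a list of [n] rows, so clearing that list yields the empty partial cover from which
    the search starts. *)
Lemma ev_clear (G : sgraph n) :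
  computes X 4 (enc_graph G) (enc_set (set0 : {set 'I_n})) (10 * n + 10).
Proof.
rewrite -(@eq_enc_set _ set0 pred0) => [|i]; last by rewrite /= inE.
have := @ev_clear_seq X _ [seq enc_set (nbhd G v) | v <- enum 'I_n] (enum 'I_n).
rewrite size_map size_enum_ord => /(_ erefl); congr (ev _ (enc_seq _) _ _ _).
apply: eq_map => v; rewrite -(@eq_enc_set _ (nbhd G v) (G v)) // => w.
by rewrite /= inE.
Qed.

Lemma ev_first A :
  computes X 5 (enc_set A) (enc_set (first_set A)) (20 * n + 20).
Proof.
have := ev_first_seq X [in A] (enum_uniq 'I_n).
rewrite size_enum_ord (@eq_enc_set _ (first_set A)
  [in take 1 [seq i <- enum 'I_n | i \in A]]) // => i.
by rewrite /= !inE enum_filter.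
Qed.

Lemma ev_fill A m :
  computes X 6 (Cons (enc_set A) (enc_nat m)) (enc_set (fill_set A m))
    (30 * n + 10).
Proof.
have := ev_fill_seq X [in A] m (enum_uniq 'I_n).
rewrite size_enum_ord (@eq_enc_set _ (fill_set A m)
  (fun i => (i \in A) || (i \in take m [seq i <- enum 'I_n | i \notin A]))) // => i.
rewrite /= !inE enum_filter; congr (_ || (i \in take m _)).
by apply: eq_filter => j; rewrite /= inE.
Qed.

Hint Resolve ev_count ev_union ev_diff ev_clear ev_first ev_fill ev_sub : prog.

Lemma ev_nbrs (G : sgraph n) A :
  computes X 7 (Cons (enc_graph G) (enc_set A))
    (enc_set [set v | nbhd G v :&: A != set0])
    (n * (100 * n + 100) + 10).
Proof.
rewrite -(@eq_enc_set _ [set v | nbhd G v :&: A != set0]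
  (fun v => nbhd G v :&: A != set0)); last first.
  by move=> v; rewrite /= inE.
suff H e : computes X 7
    (Cons (enc_seq [seq enc_seq [seq enc_bool (G v j) | j <- enum 'I_n] | v <- e])
       (enc_set A))
    (bits (fun v => nbhd G v :&: A != set0) e) (size e * (100 * n + 100) + 10).
  by have := H (enum 'I_n); rewrite size_enum_ord.
elim: e => [|v e IH]; apply: ev_le.
- by rewrite nth_lib //; apply: ev_ifF; repeat ev_step.
- by [].
- rewrite nth_lib // bits_cons [map _ _]/= enc_seq_cons.
  apply: ev_ifT; first by repeat ev_step.
  ev_step; last by repeat ev_step; apply: IH.
  have -> : enc_seq [seq enc_bool (G v j) | j <- enum 'I_n] = enc_set (nbhd G v).
    by apply: eq_enc_set => j; rewrite /= inE.
  (* The intersection of the row with [A] is obtained by two differences. *)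
  apply: (@ev_if_set _ _ _ _ _ _ (nbhd G v :\: (nbhd G v :\: A))).
    by repeat ev_step.
  rewrite setDDr setDv set0U.
  instantiate (1 := 5).
  by case: eqP => _; apply: ev_le; repeat ev_step.
- rewrite /=; lia.
Qed.

Lemma ev_degge (G : sgraph n) S c :
  computes X 8 (Cons (enc_graph G) (Cons (enc_set S) (enc_nat c)))
    (enc_set [set v | c <= #|nbhd G v :\: S|])
    (n * (100 * n + 20 * c + 100) + 10).
Proof.
rewrite -(@eq_enc_set _ [set v | c <= #|nbhd G v :\: S|]
  (fun v => c <= #|nbhd G v :\: S|)); last first.
  by move=> v; rewrite /= inE.
suff H e : computes X 8
    (Cons (enc_seq [seq enc_seq [seq enc_bool (G v j) | j <- enum 'I_n] | v <- e])
       (Cons (enc_set S) (enc_nat c)))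
    (bits (fun v => c <= #|nbhd G v :\: S|) e) (size e * (100 * n + 20 * c + 100) + 10).
  by have := H (enum 'I_n); rewrite size_enum_ord.
elim: e => [|v e IH]; apply: ev_le.
- by rewrite nth_lib //; apply: ev_ifF; repeat ev_step.
- by [].
- rewrite nth_lib // bits_cons [map _ _]/= enc_seq_cons.
  apply: ev_ifT; first by repeat ev_step.
  ev_step; last by repeat ev_step; apply: IH.
  have -> : enc_seq [seq enc_bool (G v j) | j <- enum 'I_n] = enc_set (nbhd G v).
    by apply: eq_enc_set => j; rewrite /= inE.
  have := ev_sub X #|nbhd G v :\: S| c; case: leqP => _ evs.
    by apply: ev_ifT; repeat ev_step.
  apply: ev_le; first by apply: ev_ifF; repeat ev_step.
  by lia.
- rewrite /=; lia.
Qed.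

End SetPrograms.

#[export] Hint Resolve ev_count ev_union ev_diff ev_clear ev_first ev_fill ev_sub
  ev_nbrs ev_degge : prog.

(** * Polynomial bounds *)

Definition poly_bounded (f : nat -> nat) :=
  exists p : {poly nat}, forall n, f n <= p.[n]%R.

Lemma poly_boundedC c : poly_bounded (fun=> c).
Proof. by exists c%:P%R => n; rewrite hornerC. Qed.

Lemma poly_boundedX : poly_bounded id.
Proof. by exists 'X%R => n; rewrite hornerX. Qed.

Lemma poly_boundedD f g :
  poly_bounded f -> poly_bounded g -> poly_bounded (fun n => f n + g n).
Proof.
by move=> [p fp] [q gq]; exists (p + q)%R => n; rewrite hornerD leq_add.
Qed.

Lemma poly_boundedM f g :
  poly_bounded f -> poly_bounded g -> poly_bounded (fun n => f n * g n).
Proof.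
by move=> [p fp] [q gq]; exists (p * q)%R => n; rewrite hornerM leq_mul.
Qed.

Lemma poly_boundedS f : poly_bounded f -> poly_bounded (fun n => (f n).+1).
Proof.
move=> pf; have [p fp] := poly_boundedD pf (poly_boundedC 1).
by exists p => n; rewrite -addn1.
Qed.

Lemma poly_bounded_exp f k : poly_bounded f -> poly_bounded (fun n => f n ^ k).
Proof.
move=> pf; elim: k => [|k IH]; first exact: poly_boundedC.
have [p fp] := poly_boundedM pf IH.
by exists p => n; rewrite expnS.
Qed.

Create HintDb polyb.
#[export] Hint Resolve poly_boundedC poly_boundedX poly_boundedD poly_boundedM
  poly_boundedS poly_bounded_exp : polyb.

(** * Branching on vertices of degree at least three *)

Section Greedy.

Variables (n : nat) (G : sgraph n).
Implicit Types (S T : {set 'I_n}) (a b u v w : 'I_n).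

Lemma vertex_coverP T :
  reflect (forall i j, G i j -> (i \in T) || (j \in T)) (vertex_cover G T).
Proof.
apply: (iffP forallP) => H i; first by move=> j; have /forallP/(_ j)/implyP := H i.
by apply/forallP => j; apply/implyP; apply: H.
Qed.

Lemma coverS S T : S \subset T -> vertex_cover G S -> vertex_cover G T.
Proof.
move=> /subsetP ST /vertex_coverP cS; apply/vertex_coverP => i j /cS.
by case/orP => /ST ->; rewrite ?orbT.
Qed.

Lemma cover_nbhd T v : vertex_cover G T -> v \notin T -> nbhd G v \subset T.
Proof.
move=> /vertex_coverP cT vT; apply/subsetP => w; rewrite inE => /cT.
by rewrite (negbTE vT).
Qed.

(** An edge missed by [T'] has an end in [T]; that end was given up, so its neighbours, among them
    the other end, are in [T']. *)
Lemma cover_exchange T T' :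
  vertex_cover G T ->
  (forall v, v \in T -> v \notin T' -> nbhd G v \subset T') ->
  vertex_cover G T'.
Proof.
move=> /vertex_coverP cT H; apply/vertex_coverP => i j Gij.
have [iT'|iT'] //= := boolP (i \in T').
have [iT|iT] := boolP (i \in T).
  by have /subsetP := H i iT iT'; apply; rewrite inE.
have jT : j \in T by have := cT i j Gij; rewrite (negbTE iT).
have [//|jT'] := boolP (j \in T').
by have /subsetP/(_ i) := H j jT jT'; rewrite inE adj_sym (negbTE iT') => ->.
Qed.

Lemma cover_remove T v :
  vertex_cover G T -> nbhd G v \subset T -> vertex_cover G (T :\ v).
Proof.
move=> cT Nv; apply: cover_exchange cT _ => w wT.
rewrite !inE wT andbT negbK => /eqP ->; rewrite subsetD1 Nv /=.
by rewrite inE adj_irr.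
Qed.

Definition rdeg S v := #|nbhd G v :\: S|.

Lemma rdeg1P S v w :
  rdeg S v = 1 -> G v w -> w \notin S -> nbhd G v :\: S = [set w].
Proof.
move=> /eqP/cards1P[x Ex] Gvw wS; have : w \in nbhd G v :\: S by rewrite !inE wS.
by rewrite Ex inE => /eqP <-.
Qed.

Lemma mem_rnbhd S v w : (w \in nbhd G v :\: S) = G v w && (w \notin S).
Proof. by rewrite !inE andbC. Qed.

Lemma subset_rnbhd S T v :
  S \subset T -> nbhd G v :\: S \subset T -> nbhd G v \subset T.
Proof. by move=> ST; rewrite subDset (setUidPr ST). Qed.

(* [a] and [b] are the ends of a path whose inner vertices have degree 2, so a
   cover containing both ends is not minimum. *)
Lemma path_cover S T a b :
  vertex_cover G T -> S \subset T -> a \notin S -> b \notin S ->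
  a \in T -> b \in T -> a != b -> rdeg S a = 1 -> rdeg S b = 1 ->
  (forall v, v \notin S -> v != a -> v != b -> rdeg S v = 0 \/ rdeg S v = 2) ->
  exists T', [/\ vertex_cover G T', S \subset T' & #|T'| < #|T|].
Proof.
have [m] := ubnP #|~: S|; elim: m S T a => // m IH S T a ltm cT ST aS bS aT bT
  ab da db dv.
have /eqP/cards1P[u Na] := da.
have /[!mem_rnbhd]/andP[Gau uS] : u \in nbhd G a :\: S by rewrite Na inE.
have una : u != a by apply: contraL Gau => /eqP ->; rewrite adj_irr.
have [uT|uT] := boolP (u \in T).
  exists (T :\ a); split.
  - by apply: cover_remove cT _; apply: (subset_rnbhd ST); rewrite Na sub1set.
  - by rewrite subsetD1 ST.
  - by rewrite [#|T|](cardsD1 a) aT.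
have unb : u != b by apply: contraNneq uT => ->.
have du : rdeg S u = 2.
  case: (dv u uS una unb) => // /eqP; rewrite cards_eq0 => /eqP Nu0.
  have : a \in nbhd G u :\: S by rewrite mem_rnbhd adj_sym Gau.
  by rewrite Nu0 inE.
have aNu : a \in nbhd G u :\: S by rewrite mem_rnbhd adj_sym Gau.
have /eqP/cards1P[w Ew] : #|(nbhd G u :\: S) :\ a| = 1.
  by move: du; rewrite /rdeg (cardsD1 a) aNu => -[].
have Nu : nbhd G u :\: S = [set a; w] by rewrite -(setD1K aNu) Ew.
have /[!mem_rnbhd]/andP[Guw wS] : w \in nbhd G u :\: S by rewrite Nu set22.
have wa : w != a.
  have : w \in (nbhd G u :\: S) :\ a by rewrite Ew set11.
  by rewrite in_setD1 => /andP[].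
have wu : w != u by apply: contraL Guw => /eqP ->; rewrite adj_irr.
have wT : w \in T.
  by have /vertex_coverP/(_ u w Guw) := cT; rewrite (negbTE uT).
have cardDa : #|T| = #|T :\ a|.+1 by rewrite [LHS](cardsD1 a) aT.
(* If the path is just [a], [u], [b], then [u] alone replaces both ends. *)
have [wb|wb] := eqVneq w b.
  subst w; exists (u |: (T :\ a) :\ b); split.
  - apply: cover_exchange cT _ => v vT.
    rewrite !inE vT andbT negb_or negb_and !negbK => /andP[_ vab].
    have STab : S \subset u |: (T :\ a) :\ b.
      by rewrite subsetU // !subsetD1 ST aS bS orbT.
    apply: (subset_rnbhd STab); case/orP: vab => /eqP ->; last first.
      by rewrite Na sub1set setU11.
    by rewrite (rdeg1P db _ uS) ?sub1set ?setU11 // adj_sym.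
  - by rewrite subsetU // !subsetD1 ST aS bS orbT.
  - have buT : u \notin (T :\ a) :\ b by rewrite !inE (negbTE uT) !andbF.
    rewrite cardsU1 buT cardDa ltnS (cardsD1 b (T :\ a)) !inE eq_sym ab bT.
    by [].
pose S2 := a |: (u |: S); pose T2 := u |: T.
have inS2 v : (v \in S2) = [|| v == a, v == u | v \in S] by rewrite !inE.
have Gv v : v \notin S2 -> v != w ->
    nbhd G v :\: S2 = nbhd G v :\: S.
  move=> vS2 vw; apply/setP => z; rewrite !mem_rnbhd inS2.
  have [vz|] //= := boolP (G v z); move: vS2; rewrite inS2 !negb_or.
  case/and3P=> va vu vS; case: eqP => [za|_] /=.
    have : v \in nbhd G a :\: S by rewrite mem_rnbhd -za adj_sym vz.
    by rewrite Na inE (negbTE vu).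
  case: eqP => [zu|_] //=.
  have : v \in nbhd G u :\: S by rewrite mem_rnbhd -zu adj_sym vz.
  by rewrite Nu !inE (negbTE va) (negbTE vw).
have aw : ~~ G a w.
  apply: contra wu => Gaw; have : w \in nbhd G a :\: S by rewrite mem_rnbhd Gaw.
  by rewrite Na inE.
have dw : rdeg S2 w = 1.
  have dw2 : rdeg S w = 2.
    case: (dv w wS wa wb) => // /eqP; rewrite cards_eq0 => /eqP Nw0.
    have : u \in nbhd G w :\: S by rewrite mem_rnbhd adj_sym Guw.
    by rewrite Nw0 inE.
  have uNw : u \in nbhd G w :\: S by rewrite mem_rnbhd adj_sym Guw.
  move: dw2; rewrite /rdeg (cardsD1 u) uNw => -[<-]; apply: eq_card => z.
  rewrite mem_rnbhd inS2 in_setD1 mem_rnbhd !negb_or.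
  have [->|za] := eqVneq z a; first by rewrite adj_sym (negbTE aw) !andbF.
  by rewrite /= andbCA.
have bS2 : b \notin S2 by rewrite inS2 !negb_or bS eq_sym ab eq_sym unb.
have wS2 : w \notin S2 by rewrite inS2 !negb_or wS wa wu.
have [|||||||||||T' [cT' ST' ltT']] := IH S2 T2 w.
- rewrite -ltnS; apply: leq_trans ltm; rewrite ltnS; apply: proper_card.
  rewrite properE setCS; apply/andP; split.
    by apply/subsetP => z; rewrite inS2 => ->; rewrite !orbT.
  by apply/negP; rewrite setCS => /subsetP/(_ a); rewrite inS2 eqxx (negbTE aS) =>
    /(_ isT).
- by apply: coverS cT; rewrite subsetUr.
- by rewrite !subUset !sub1set !inE aT eqxx orbT /= subsetU // ST orbT.
- exact: wS2.
- exact: bS2.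
- by rewrite !inE wT orbT.
- by rewrite !inE bT orbT.
- exact: wb.
- exact: dw.
- by rewrite /rdeg Gv // eq_sym.
- move=> v vS2 vw vb; rewrite /rdeg Gv //; apply: dv => //;
    by move: vS2; rewrite inS2 !negb_or => /and3P[].
exists (T' :\ a); split.
- apply: cover_remove cT' _; apply: (@subset_rnbhd S).
    by apply: subset_trans ST'; apply/subsetP => z zS; rewrite inS2 zS !orbT.
  by rewrite Na sub1set; apply: (subsetP ST'); rewrite inS2 eqxx orbT.
- rewrite subsetD1 aS andbT; apply: subset_trans ST'.
  by apply/subsetP => z zS; rewrite inS2 zS !orbT.
- move: ltT'; rewrite /T2 cardsU1 uT [#|T'|](cardsD1 a).
  by rewrite (subsetP ST') ?inS2 ?eqxx.
Qed.

Definition deg_ge S c := [set v | c <= rdeg S v] :\: S.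

(* In a graph of maximum degree 2, any neighbour of a leaf is in some minimum cover
   and, if there are no leaves, the components are cycles and isolated vertices. *)
Definition leaves S := deg_ge S 1 :\: [set v | 2 <= rdeg S v].

Definition picks S :=
  if leaves S == set0 then deg_ge S 1
  else [set v | nbhd G v :&: leaves S != set0] :\: S.

(** If [u] is not in [T], its neighbours are. A leaf next to [u] is simply swapped for [u]. On a
    cycle, adding [u] to both [S] and [T] leaves a path whose ends, the neighbours of [u], are both
    in [T]; [path_cover] then wins back the extra vertex. *)
Lemma picks_exchange S T u :
  deg_ge S 3 = set0 -> u \in picks S -> vertex_cover G T -> S \subset T ->
  exists T', [/\ vertex_cover G T', u |: S \subset T' & #|T'| <= #|T|].
Proof.
move=> /setP deg3 upick cT ST.
have [uT|uT] := boolP (u \in T).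
  by exists T; split=> //; rewrite subUset sub1set uT.
move: upick; rewrite /picks; case: eqP => [/setP L0|_].
  rewrite !inE => /andP[uS du].
  have deg02 v : v \notin S -> rdeg S v = 0 \/ rdeg S v = 2.
    move: (L0 v) (deg3 v); rewrite !inE => + + vS; rewrite vS /=.
    by case: (rdeg S v) => [|[|[|k]]] //; [left | right].
  have {du} : rdeg S u = 2 by case: (deg02 u uS) => // E; rewrite E in du.
  move=> du; have /cards2P[a [b [ab Nu]]] : #|nbhd G u :\: S| == 2 by apply/eqP.
  have /[!mem_rnbhd]/andP[Gua aS] : a \in nbhd G u :\: S by rewrite Nu set21.
  have /[!mem_rnbhd]/andP[Gub bS] : b \in nbhd G u :\: S by rewrite Nu set22.
  have /subsetP NuT := cover_nbhd cT uT.
  have degu v : v \notin S -> G u v -> rdeg (u |: S) v = 1.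
    move=> vS Guv; have uN : u \in nbhd G v :\: S by rewrite mem_rnbhd adj_sym Guv.
    have : rdeg S v = 2.
      by case: (deg02 v vS) => // /eqP; rewrite /rdeg (cardsD1 u) uN.
    rewrite /rdeg (cardsD1 u) uN => -[<-]; congr #|pred_of_set _|.
    by apply/setP=> z; rewrite in_setD1 !mem_rnbhd !inE negb_or andbCA.
  have una : a != u by apply: contraL Gua => /eqP ->; rewrite adj_irr.
  have unb : b != u by apply: contraL Gub => /eqP ->; rewrite adj_irr.
  case: (@path_cover (u |: S) (u |: T) a b) => //.
  - by apply: coverS cT; rewrite subsetUr.
  - by rewrite setUS.
  - by rewrite !inE negb_or una.
  - by rewrite !inE negb_or unb.
  - by rewrite !inE NuT ?orbT // inE.
  - by rewrite !inE NuT ?orbT // inE.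
  - exact: degu.
  - exact: degu.
  - move=> v; rewrite !inE negb_or => /andP[vu vS] va vb.
    suff <- : rdeg S v = rdeg (u |: S) v by apply: deg02.
    congr #|pred_of_set _|; apply/setP => z; rewrite !mem_rnbhd !inE negb_or.
    case: eqP => [->|//]; rewrite /= andbF.
    apply/negbTE/negP => /andP[Gvu _].
    have : v \in nbhd G u :\: S by rewrite mem_rnbhd adj_sym Gvu.
    by rewrite Nu !inE (negbTE va) (negbTE vb).
  - by move=> T' [cT' ST' ltT']; exists T'; split=> //; move: ltT'; rewrite cardsU1 uT.
rewrite !inE => /andP[uS /set0Pn[v]]; rewrite !inE => /and3P[Guv].
rewrite -ltnNge ltnS => ltd /andP[vS dv].
have {ltd} {}dv : rdeg S v = 1 by apply/eqP; rewrite eqn_leq ltd.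
have Nv := rdeg1P dv (_ : G v u) uS.
exists (u |: (T :\ v)).
have ST' : S \subset u |: (T :\ v) by rewrite subsetU // subsetD1 ST vS orbT.
have vT : v \in T.
  by have /vertex_coverP/(_ u v Guv) := cT; rewrite (negbTE uT).
split.
- apply: cover_exchange cT _ => w wT.
  rewrite !inE wT andbT negb_or negbK => /andP[_ /eqP ->].
  by apply: (subset_rnbhd ST'); rewrite Nv ?sub1set ?setU11 // adj_sym.
- by rewrite subUset sub1set setU11.
- by rewrite cardsU1 !inE (negbTE uT) andbF /= [#|T|](cardsD1 v) vT.
Qed.

Lemma first_set0 (T : finType) : first_set (set0 : {set T}) = set0.
Proof. by apply/setP => x; rewrite /first_set enum_set0 !inE. Qed.

Lemma first_setP (T : finType) (A : {set T}) :
  A != set0 -> exists2 x, x \in A & first_set A = [set x].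
Proof.
rewrite -cards_eq0 /first_set cardE.
case E : (enum A) => [|x s] //= _; exists x.
  by rewrite -mem_enum E mem_head.
by apply/setP => y; rewrite take0 !inE.
Qed.

Lemma nbrs_set1 v : [set w | nbhd G w :&: [set v] != set0] = nbhd G v.
Proof.
apply/setP => w; rewrite !inE; apply/set0Pn/idP => [[x]|Gvw].
  by rewrite !inE => /andP[Gwx /eqP <-]; rewrite adj_sym.
by exists v; rewrite !inE adj_sym Gvw eqxx.
Qed.

(** [k] is fuel: every round adds a vertex outside [S], so [#|~: S|] rounds suffice. *)
Fixpoint greedy k S :=
  if k is k'.+1 then
    if picks S == set0 then S else greedy k' (S :|: first_set (picks S))
  else S.

Lemma picks_notin S : [disjoint picks S & S].
Proof.
by rewrite /picks -setI_eq0; case: ifP => _; rewrite setIDAC setDIl setDv setI0.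
Qed.

(** A leaf has a neighbour outside [S], so nothing to pick means no leaves, and then no edge outside
    [S] either. *)
Lemma picks_eq0 S : picks S = set0 -> vertex_cover G S.
Proof.
rewrite /picks; case: eqP => [_ /setP E|/eqP/set0Pn[v vL] /setP E].
  apply/vertex_coverP => i j Gij; have := E i; rewrite !inE.
  case: (i \in S) => //=; apply: contraFT => jS.
  by apply/card_gt0P; exists j; rewrite mem_rnbhd Gij.
have := vL; rewrite !inE => /and3P[_ vS /card_gt0P[w]].
rewrite mem_rnbhd => /andP[Gvw wS].
have := E w; rewrite !inE wS /= => /negbT; rewrite negbK => /eqP/setP/(_ v).
by rewrite in_setI vL !inE adj_sym Gvw.
Qed.

Lemma deg_geS S S' c : S \subset S' -> deg_ge S' c \subset deg_ge S c.
Proof.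
move=> SS'; apply/subsetP => v; rewrite !inE => /andP[vS' dv].
rewrite (contra (subsetP SS' v)) //=; apply: leq_trans dv _.
exact/subset_leq_card/setDS.
Qed.

(** [picks_exchange] turns any competitor into one that is no larger and contains the vertex just
    added; maximum degree 2 persists by [deg_geS]. *)
Lemma greedyP k S :
  deg_ge S 3 = set0 -> #|~: S| <= k ->
  [/\ S \subset greedy k S, vertex_cover G (greedy k S)
    & forall T, vertex_cover G T -> S \subset T -> #|greedy k S| <= #|T|].
Proof.
elim: k S => [|k IH] S deg3 Sk /=.
  have -> : S = setT.
    by rewrite -[S]setCK; move: Sk; rewrite leqn0 cards_eq0 => /eqP ->; rewrite setC0.
  split=> // [|T _ /subset_leq_card //].
  by apply/vertex_coverP => i j _; rewrite inE.
case: eqP => [/picks_eq0 cS|/eqP/first_setP[u upick ->]].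
  by split=> // T _ /subset_leq_card.
have uS : u \notin S.
  by have := picks_notin S; rewrite disjoint_subset => /subsetP/(_ u upick).
have [||sub cov opt] := IH (S :|: [set u]).
- apply/eqP; rewrite -subset0 -deg3; apply: deg_geS; exact: subsetUl.
- rewrite -ltnS; apply: leq_trans Sk; apply: proper_card; apply/properP; split.
    by rewrite setCS subsetUl.
  by exists u; rewrite !inE ?eqxx ?orbT.
split=> // [|T cT ST]; first by apply: subset_trans sub; apply: subsetUl.
have [T' [cT' ST' leT']] := picks_exchange deg3 upick cT ST.
by apply: leq_trans leT'; apply: opt => //; rewrite setUC.
Qed.

End Greedy.

Lemma subset_fill (T : finType) (A : {set T}) m : A \subset fill_set A m.
Proof. exact: subsetUl. Qed.

Lemma card_fill (T : finType) (A : {set T}) m :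
  #|A| + m <= #|T| -> #|fill_set A m| = #|A| + m.
Proof.
move=> Am; rewrite /fill_set cardsU.
have -> : A :&: [set x in take m (enum (~: A))] = set0.
  apply/setP => x; rewrite !inE; apply/negbTE/negP => /andP[xA /mem_take].
  by rewrite mem_enum inE xA.
rewrite cards0 subn0 cardsE; congr (_ + _).
have /card_uniqP -> := take_uniq m (enum_uniq (~: A)).
by rewrite size_takel // -cardE cardsCs setCK; lia.
Qed.

(** A nonempty [B] is a singleton, and by [nbrs_set1] the second set consists of its neighbours
    outside [S]. It is written in the form in which the library program computes it. *)
Definition branch3_step : step_function := fun n G k S =>
  let B := first_set (deg_ge G S 3) in
  if B == set0 then
    let C := greedy G n S in
    Solved (if #|C| <= k then Some (fill_set C (k - #|C|)) else None)
  else Branch [:: B; [set v | nbhd G v :&: B != set0] :\: S].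

Lemma branch3_correct n (G : sgraph n) k S :
  k <= n -> correct_outcome G k S (branch3_step G k S).
Proof.
move=> kn; rewrite /branch3_step.
have [E|/first_setP[v vB ->]] := eqVneq (deg_ge G S 3) set0.
  have -> : first_set (deg_ge G S 3) == set0.
    by rewrite E first_set0.
  have Sn : #|~: S| <= n by rewrite -[n in _ <= n]card_ord max_card.
  have [sub cov opt] := greedyP E Sn.
  case: leqP => Ck /=.
    split; last exact: subset_trans sub (subset_fill _ _).
    rewrite inE (coverS (subset_fill _ _) cov) /= card_fill ?subnKC //.
    by rewrite card_ord.
  move=> T; rewrite inE => /andP[cT /eqP Tk]; apply: contraTN Ck => ST.
  by rewrite -leqNgt -Tk opt.
move: vB; rewrite !inE => /andP[vS dv].
have nS0 : [set v] != set0 :> {set 'I_n}.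
  by apply/set0Pn; exists v; rewrite inE.
rewrite (negbTE nS0).
rewrite nbrs_set1.
split=> // [D|T].
  rewrite !inE => /orP[] /eqP ->; split=> //.
  - by rewrite disjoints1.
  - by rewrite -cards_eq0 -lt0n; apply: leq_trans dv.
  - by rewrite -setI_eq0 setIDAC -setIDA setDv setI0.
rewrite inE => /andP[cT _] ST; have [vT|vT] := boolP (v \in T).
  by exists [set v]; rewrite ?inE ?eqxx // sub1set.
exists (nbhd G v :\: S); first by rewrite !inE eqxx orbT.
exact: subset_trans (subsetDl _ _) (cover_nbhd cT vT).
Qed.

Lemma branch3_vector n (G : sgraph n) k S Ds :
  branch3_step G k S = Branch Ds ->
  exists2 d, 2 < d & [seq #|D| | D : {set 'I_n} <- Ds] = [:: 1; d].
Proof.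
rewrite /branch3_step; case: eqP => // /eqP B0 [<-] /=.
have : deg_ge G S 3 != set0.
  by apply: contra B0 => /eqP ->; rewrite first_set0.
case/first_setP=> v + ->; rewrite !inE => /andP[vS dv].
eexists; last by rewrite cards1.
by rewrite nbrs_set1.
Qed.

(** * A program for the branching step *)

Definition one := ECons ENil ENil.
Definition two := ECons ENil one.
Definition three := ECons ENil two.

Definition deg_ge_expr (g s c : expr) :=
  ECall 3 (ECons (ECall 8 (ECons g (ECons s c))) s).

Definition leaves_expr (g s : expr) :=
  ECall 3 (ECons (deg_ge_expr g s one) (ECall 8 (ECons g (ECons s two)))).

Definition picks_expr (g s : expr) :=
  EIf (ECall 0 (leaves_expr g s))
    (ECall 3 (ECons (ECall 7 (ECons g (leaves_expr g s))) s))
    (deg_ge_expr g s one).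

Definition greedy_body :=
  EIf (ECall 0 (picks_expr x1 x2))
    (ECall 9 (ECons x1 (ECall 2 (ECons x2 (ECall 5 (picks_expr x1 x2)))))) x2.

Definition branch3_main :=
  let g := EHd x1 in let k := ETl x1 in
  let B := ECall 5 (deg_ge_expr g x2 three) in
  let C := ECall 9 (ECons g x2) in
  let r := ECall 1 (ECons k (ECall 0 C)) in
  EIf (ECall 0 B)
    (ECons ETrue (ECons B
      (ECons (ECall 3 (ECons (ECall 7 (ECons g B)) x2)) ENil)))
    (EIf r (ECons ENil (ECall 6 (ECons C (ETl r)))) ENil).

Definition branch3_code := Program (set_lib ++ [:: greedy_body]) branch3_main.

Section Branch3Code.

Variables (n : nat) (G : sgraph n).
Implicit Types S : {set 'I_n}.

Local Notation F := (set_lib ++ [:: greedy_body]).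

Lemma ev_lit x m :
  ev F x (iter m (ECons ENil) ENil) (enc_nat m) (2 * m + 1).
Proof.
elim: m => [|m IH]; first exact: ev_nil.
by apply: ev_le; [exact: ev_cons (ev_nil _ _) IH | lia].
Qed.

Lemma ev_deg_ge_expr x g s c S t :
  ev F x g (enc_graph G) t -> ev F x s (enc_set S) t -> c <= 3 ->
  ev F x (deg_ge_expr g s (iter c (ECons ENil) ENil)) (enc_set (deg_ge G S c))
    (3 * t + 100 * (n * n) + 200 * n + 50).
Proof.
move=> evg evs c3; apply: ev_le.
  by rewrite /deg_ge_expr; repeat ev_step; eauto using ev_lit, ev_diff, ev_degge.
nia.
Qed.

Lemma ev_leaves_expr x g s S t :
  ev F x g (enc_graph G) t -> ev F x s (enc_set S) t ->
  ev F x (leaves_expr g s) (enc_set (leaves G S))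
    (5 * t + 200 * (n * n) + 400 * n + 200).
Proof.
move=> evg evs; apply: ev_le.
  rewrite /leaves_expr; repeat ev_step; eauto.
  - exact: (ev_deg_ge_expr (c := 1) evg evs).
  - exact: (ev_lit _ 2).
  - exact: ev_diff.
nia.
Qed.

Lemma ev_picks_expr x g s S t :
  ev F x g (enc_graph G) t -> ev F x s (enc_set S) t ->
  ev F x (picks_expr g s) (enc_set (picks G S))
    (15 * t + 600 * (n * n) + 1200 * n + 1000).
Proof.
move=> evg evs; have evL := ev_leaves_expr evg evs; apply: ev_le.
  apply: (@ev_if_set _ _ _ _ _ _ (leaves G S)).
    by ev_step; [exact: evL | ev_step].
  instantiate (1 := 10 * t + 400 * (n * n) + 700 * n + 700).
  rewrite /picks; case: eqP => _; apply: ev_le.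
  - exact: (ev_deg_ge_expr (c := 1) evg evs).
  - lia.
  - by repeat (ev_step || exact: evL || exact: evg || exact: evs).
  - lia.
lia.
Qed.

Lemma ev_greedy m S :
  #|~: S| <= m ->
  ev F (Cons (enc_graph G) (enc_set S)) (nth ENil F 9) (enc_set (greedy G m S))
    (m.+1 * (1200 * (n * n) + 3000 * n + 4000)).
Proof.
have evp S' : ev F (Cons (enc_graph G) (enc_set S')) (picks_expr x1 x2)
    (enc_set (picks G S')) (600 * (n * n) + 1200 * n + 1100).
  by apply: ev_le; [apply: (@ev_picks_expr _ _ _ _ 2); repeat ev_step | lia].
have [K EK] : exists K, K = 1200 * (n * n) + 3000 * n + 4000 by eexists.
rewrite -EK; elim: m S => [|m IH] S Sm; apply: ev_le.
- apply: (@ev_if_set _ _ _ _ _ _ (picks G S)); first by ev_step; [apply: evp | ev_step].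
  (* The program has no fuel. When the fuel of [greedy] runs out, no vertex is left outside [S], so
     the program stops as well. *)
  suff -> : picks G S == set0 by repeat ev_step.
  have := picks_notin G S; rewrite disjoints_subset; move: Sm.
  by rewrite leqn0 cards_eq0 => /eqP ->; rewrite subset0.
- lia.
- apply: (@ev_if_set _ _ _ _ _ _ (picks G S)); first by ev_step; [apply: evp | ev_step].
  instantiate (1 := m.+1 * K + (600 * (n * n) + 1200 * n + 2000 + 50 * n)).
  rewrite (_ : greedy G m.+1 S = if picks G S == set0 then S
    else greedy G m (S :|: first_set (picks G S))) //.
  case: eqP => [_|/eqP P0]; first by apply: ev_le; [repeat ev_step | lia].
  apply: ev_le.
    ev_step; last first.
      apply: IH; have [u uP ->] := first_setP P0.
      rewrite -ltnS; apply: leq_trans Sm; apply: proper_card; apply/properP; split.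
        by rewrite setCS subsetUl.
      exists u; rewrite !inE ?eqxx ?orbT //.
      by have := picks_notin G S; rewrite disjoint_subset => /subsetP/(_ u uP).
    by repeat (ev_step || apply: evp).
  lia.
- lia.
Qed.

Lemma ev_branch3 k S :
  k <= n ->
  ev F (enc_subproblem G k S) branch3_main (enc_outcome (branch3_step G k S))
    (1000 * (100 * n.+1 ^ 3)).
Proof.
move=> kn; have Sn : #|~: S| <= n by rewrite -[n in _ <= n]card_ord max_card.
have [N EN] : exists N, N = n.+1 ^ 3 by eexists.
have [n1N n2N cN] : [/\ n < N, n * n <= N & 
    n.+1 * (1200 * (n * n) + 3000 * n + 4000) <= 100 * (100 * N)].
  by rewrite EN !expnS expn0 muln1; split; nia.
have ev_g : ev F (enc_subproblem G k S) (EHd x1) (enc_graph G) 3.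
  by rewrite /enc_subproblem; repeat ev_step.
have ev_k : ev F (enc_subproblem G k S) (ETl x1) (enc_nat k) 3.
  by rewrite /enc_subproblem; repeat ev_step.
have ev_S : ev F (enc_subproblem G k S) x2 (enc_set S) 3.
  by apply: ev_le; [rewrite /enc_subproblem; repeat ev_step | ].
rewrite -EN; clear EN; set x := enc_subproblem G k S in ev_g ev_k ev_S *.
have evB : ev F x (ECall 5 (deg_ge_expr (EHd x1) x2 three))
    (enc_set (first_set (deg_ge G S 3))) (1000 * N).
  apply: ev_le.
    by ev_step; [apply: (ev_deg_ge_expr (c := 3) ev_g ev_S) | ev_step].
  lia.
have evC : ev F x (ECall 9 (ECons (EHd x1) x2)) (enc_set (greedy G n S))
    (110 * (100 * N)).
  apply: ev_le.
    ev_step; last exact: ev_greedy.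
    by ev_step; [exact: ev_g | exact: ev_S].
  lia.
apply: ev_le.
  apply: (@ev_if_set _ _ _ _ _ _ (first_set (deg_ge G S 3))).
    by ev_step; [exact: evB | ev_step].
  instantiate (1 := 500 * (100 * N)).
  rewrite /branch3_step; case: ifP => _; last first.
    apply: ev_le.
      by repeat (exact: evB || exact: ev_g || exact: ev_S || ev_step).
    nia.
  have Cn : #|greedy G n S| <= n by rewrite -[n in _ <= n]card_ord max_card.
  have evr : ev F x (ECall 1 (ECons (ETl x1) (ECall 0 (ECall 9 (ECons (EHd x1) x2)))))
    (if #|greedy G n S| <= k then Cons Nil (enc_nat (k - #|greedy G n S|)) else Nil)
    (120 * (100 * N)).
    apply: ev_le.
      by repeat (exact: evC || exact: ev_k || ev_step).
    lia.
  move: evr; case: leqP => Ck evr; apply: ev_le.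
  - apply: ev_ifT; first exact: evr.
    by repeat (exact: evC || exact: evr || ev_step).
  - lia.
  - by apply: ev_ifF; [exact: evr | ev_step].
  - lia.
lia.
Qed.

End Branch3Code.

Lemma branch3_polytime : exists p : {poly nat},
  forall n (G : sgraph n) k S, k <= n -> subproblem branch3_step G k S ->
  exists2 t, t <= p.[n]%R
           & runs branch3_code (enc_subproblem G k S)
               (enc_outcome (branch3_step G k S)) t.
Proof.
have [p Hp] : poly_bounded (fun n => 1000 * (100 * n.+1 ^ 3)).
  by auto 10 with polyb.
exists p => n G k S kn _; have [t tle evt] := ev_branch3 G S kn.
by exists t => //; apply: leq_trans tle (Hp n).
Qed.

Definition branch3 : branching_algorithm :=
  BranchingAlgorithm (fun n G k S kn _ => branch3_correct G S kn) branch3_polytime.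

(** * Searching the branching tree *)

(** The fraction of [k]-sets that contain [s] given elements is the product of the
    [(k - i) / (n - i)] with [i < s], each at most [k / n]. Denominators are cleared. *)
Lemma bin_sub_ratio n k s :
  s <= k <= n -> 'C(n - s, k - s) * n ^ s <= 'C(n, k) * k ^ s.
Proof.
elim: s => [|s IH] /andP[sk kn]; first by rewrite !subn0 !expn0.
have {}IH : 'C(n - s, k - s) * n ^ s <= 'C(n, k) * k ^ s by apply: IH; lia.
have ns0 : 0 < n - s by lia.
have := mul_bin_diag (n - s) (k - s.+1); rewrite -subnS -subSn // subSS => E.
have le1 : (k - s) * n <= (n - s) * k by rewrite !mulnBl (mulnC n k); nia.
rewrite -(leq_pmul2l ns0) !expnS mulnA E.
apply: leq_trans (_ : ((k - s) * n) * ('C(n - s, k - s) * n ^ s) <= _); first lia.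
by apply: leq_trans (leq_mul le1 IH) _; lia.
Qed.

(** Removing [S] is injective on the supersets of [S]. *)
Lemma card_supersets (T : finType) (S : {set T}) k :
  #|S| <= k ->
  #|[set X : {set T} | (S \subset X) && (#|X| == k)]| <=
    'C(#|T| - #|S|, k - #|S|).
Proof.
move=> Sk; have -> : #|T| - #|S| = #|~: S| by rewrite [#|~: S|]cardsCs setCK.
rewrite -cards_draws -(@card_in_imset _ _ (fun X => X :\: S)).
  apply/subset_leq_card/subsetP => _ /imsetP[X /[!inE] /andP[SX /eqP Xk] ->].
  by rewrite subDset setUCr subsetT cardsD (setIidPr SX) Xk eqxx.
move=> X Y /[!inE] /andP[SX _] /andP[SY _] E.
by rewrite -(setID X S) -(setID Y S) (setIidPr SX) (setIidPr SY) E.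
Qed.

Section Search.

(** * The search program and its running time *)

Variable A : branching_algorithm.

(* Argument: pending partial covers, the instance, and the size bound. Index 12 is
   the main expression of the step program. *)
Definition search_body :=
  let o := ECall 12 (ECons (EHd x2) (EHd x1)) in
  EIf x1
    (EIf (ECall 1 (ECons (ETl x2) (ECall 0 (EHd x1))))
       (EIf o
          (EIf (EHd o) (ECall 9 (ECons (ECall 10 (ECons (ETl o) x1)) x2)) o)
          (ECall 9 (ECons (ETl x1) x2)))
       (ECall 9 (ECons (ETl x1) x2)))
    ENil.

(** The parent stays on top of the stack while its children are formed, and is dropped at the
    end. *)
Definition push_body :=
  EIf x1
    (ECons (ECall 2 (ECons (EHd x2) (EHd x1))) (ECall 10 (ECons (ETl x1) x2)))
    (ETl x2).

(** There is no exit at level [k]: if a cover exists, a search at some level up to [k] finds it. *)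
Definition deepen_body :=
  let r := ECall 9 (ECons (ECons (ECall 4 (EHd x1)) ENil) EArg) in
  EIf r (ETl r) (ECall 11 (ECons x1 (ECons ENil x2))).

(** Behind the nine library functions these get the indices 9 to 12; the functions of the step
    program follow from 13 on. *)
Definition search_funs :=
  [:: search_body; push_body; deepen_body; relocate 13 (main (step_code A))] ++
  [seq relocate 13 b | b <- funs (step_code A)].

Definition search_code :=
  Program (set_lib ++ search_funs) (ECall 11 (ECons EArg ENil)).

Local Notation F := (set_lib ++ search_funs).

Section Instance.

Variables (n : nat) (G : sgraph n) (k P : nat).
Implicit Types S D C : {set 'I_n}.
Hypothesis kn : k <= n.
Hypothesis stepP : forall S, subproblem (step A) G k S ->
  exists2 t, t <= P
           & runs (step_code A) (enc_subproblem G k S)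
               (enc_outcome (step A G k S)) t.

Local Notation sub := (subproblem (step A) G k).

Lemma ev_step_code S : sub S ->
  ev F (enc_subproblem G k S) (nth ENil F 12) (enc_outcome (step A G k S)) P.
Proof.
move=> /stepP[t tP evt]; exists t => //.
have := eval_relocate (set_lib ++ [:: search_body; push_body; deepen_body;
  relocate 13 (main (step_code A))]) evt.
exact.
Qed.

Lemma depth_enc_set (S : {set 'I_n}) : depth (enc_set S) <= n.+1.
Proof.
rewrite -add1n -[X in _ + X](size_enum_ord n).
by apply: depth_enc_seq => i; case: (i \in S).
Qed.

Lemma depth_enc_subproblem S : depth (enc_subproblem G k S) <= 2 * n + 5.
Proof.
have := depth_enc_set S.
have : depth (enc_nat k) <= k.
  have := @depth_enc_seq 0 _ (fun=> Nil) (nseq k tt) (fun=> isT).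
  by rewrite map_nseq size_nseq.
suff : depth (enc_graph G) <= n.+1 + n.
  by move: kn; rewrite /enc_subproblem /enc_instance /=; lia.
rewrite /enc_graph -[X in _ + X](size_enum_ord n).
apply: depth_enc_seq => i; rewrite -add1n -[X in _ + X](size_enum_ord n).
by apply: depth_enc_seq => j; case: (G i j).
Qed.

(** The step program writes the list of children within [P] steps, starting from an input of depth
    at most [2 * n + 5]. *)
Lemma size_branching S Ds :
  sub S -> step A G k S = Branch Ds -> size Ds <= P + 2 * n + 5.
Proof.
move=> subS E; have [t tP evt] := stepP subS.
have := eval_depth evt; rewrite E => h1.
have h2 : depth (enc_seq [seq enc_set D | D <- Ds]) <= depth (enc_outcome (Branch Ds)).
  by rewrite /= leqW // leq_maxr.
rewrite -(size_map (fun D => enc_set D)); apply: leq_trans (size_le_depth _) _.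
have h3 := depth_enc_subproblem S; move: h1 h2 h3.
by move: (depth _) (depth _) (depth _); lia.
Qed.

Definition enc_sets (Ss : seq {set 'I_n}) :=
  enc_seq [seq enc_set T | T : {set 'I_n} <- Ss].

Lemma ev_push S Ds st :
  ev F (Cons (enc_sets Ds) (Cons (enc_set S) (enc_sets st))) (nth ENil F 10)
    (enc_sets ([seq S :|: D | D <- Ds] ++ st)) (size Ds * (30 * n + 40) + 10).
Proof.
elim: Ds => [|D Ds IH]; apply: ev_le.
- by apply: ev_ifF; repeat ev_step.
- by [].
- apply: ev_ifT; first by repeat ev_step.
  ev_step; first by repeat (exact: ev_union || ev_step).
  by ev_step; [repeat ev_step | exact: IH].
- rewrite /=; lia.
Qed.

Definition search_runs l st v T :=
  ev F (Cons (enc_sets st) (Cons (enc_instance G k) (enc_nat l)))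
    (nth ENil F 9) v T.

Definition test_cost := 40 * n + 100.

(** Without local bindings the outcome is recomputed at each of up to three uses, hence [3 * P]. The
    last summand pays for pushing the children. *)
Definition visit_cost :=
  test_cost + 3 * P + 200 + (P + 2 * n + 5) * (30 * n + 40).

Lemma search_nil l : search_runs l [::] Nil 10.
Proof.
by apply: ev_le; [apply: ev_ifF; repeat ev_step | ].
Qed.

Lemma ev_size_test l S st :
  ev F (Cons (enc_sets (S :: st)) (Cons (enc_instance G k) (enc_nat l)))
    (ECall 1 (ECons (ETl x2) (ECall 0 (EHd x1))))
    (if #|S| <= l then Cons Nil (enc_nat (l - #|S|)) else Nil) (30 * n + 50).
Proof.
have Sn : #|S| <= n by rewrite -[n in _ <= n]card_ord max_card.
apply: ev_le.
  by ev_step; [repeat (exact: ev_count || ev_step) | exact: ev_sub].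
lia.
Qed.

Lemma search_big l S st v t :
  l < #|S| -> search_runs l st v t -> search_runs l (S :: st) v (test_cost + t).
Proof.
move=> lS evst; have := ev_size_test l S st; rewrite leqNgt lS /= => evt.
apply: ev_le.
  apply: ev_ifT; first by repeat ev_step.
  apply: ev_ifF; first exact: evt.
  by ev_step; last exact: evst; repeat ev_step.
rewrite /test_cost; lia.
Qed.

Lemma ev_outcome l S st : sub S ->
  ev F (Cons (enc_sets (S :: st)) (Cons (enc_instance G k) (enc_nat l)))
    (ECall 12 (ECons (EHd x2) (EHd x1))) (enc_outcome (step A G k S)) (P + 10).
Proof.
move=> subS; apply: ev_le.
  by ev_step; last exact: ev_step_code; repeat ev_step.
lia.
Qed.

Lemma search_none l S st v t :
  sub S -> #|S| <= l -> step A G k S = Solved None ->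
  search_runs l st v t -> search_runs l (S :: st) v (visit_cost + t).
Proof.
move=> subS lS E evst; have := ev_size_test l S st; rewrite lS /= => evt.
have := ev_outcome l st subS; rewrite E /= => evo.
apply: ev_le.
  apply: ev_ifT; first by repeat ev_step.
  apply: ev_ifT; first exact: evt.
  apply: ev_ifF; first exact: evo.
  by ev_step; last exact: evst; repeat ev_step.
rewrite /visit_cost /test_cost; lia.
Qed.

Lemma search_some l S st C :
  sub S -> #|S| <= l -> step A G k S = Solved (Some C) ->
  search_runs l (S :: st) (Cons Nil (enc_set C)) visit_cost.
Proof.
move=> subS lS E; have := ev_size_test l S st; rewrite lS /= => evt.
have := ev_outcome l st subS; rewrite E /= => evo.
apply: ev_le.
  apply: ev_ifT; first by repeat ev_step.
  apply: ev_ifT; first exact: evt.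
  apply: ev_ifT; first exact: evo.
  apply: ev_ifF; last exact: evo.
  by apply: ev_hd; exact: evo.
rewrite /visit_cost /test_cost; lia.
Qed.

Lemma search_branch l S st Ds v t :
  sub S -> #|S| <= l -> step A G k S = Branch Ds ->
  search_runs l ([seq S :|: D | D <- Ds] ++ st) v t ->
  search_runs l (S :: st) v (visit_cost + t).
Proof.
move=> subS lS E evst; have := ev_size_test l S st; rewrite lS /= => evt.
have := ev_outcome l st subS; rewrite E /= => evo.
have sDs := size_branching subS E.
apply: ev_le.
  apply: ev_ifT; first by repeat ev_step.
  apply: ev_ifT; first exact: evt.
  apply: ev_ifT; first exact: evo.
  apply: ev_ifT; first by apply: ev_hd; exact: evo.
  ev_step; last exact: evst.
  ev_step; last by repeat ev_step.
  ev_step; last exact: ev_push.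
  by ev_step; [apply: ev_tl; exact: evo | repeat ev_step].
rewrite /visit_cost /test_cost.
have := leq_mul sDs (leqnn (30 * n + 40)); lia.
Qed.

Definition deepen_runs l v T :=
  ev F (Cons (enc_instance G k) (enc_nat l)) (nth ENil F 11) v T.

(** A successful search is run twice, once as the condition and once for its result. *)
Lemma deepen_found l C t :
  search_runs l [:: set0] (Cons Nil (enc_set C)) t ->
  deepen_runs l (enc_set C) (2 * t + 20 * n + 100).
Proof.
move=> evs.
have evr : ev F (Cons (enc_instance G k) (enc_nat l))
    (ECall 9 (ECons (ECons (ECall 4 (EHd x1)) ENil) EArg))
    (Cons Nil (enc_set C)) (t + 10 * n + 30).
  apply: ev_le.
    ev_step; last exact: evs.
    ev_step; last exact: ev_arg.
    ev_step; last exact: ev_nil.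
    by ev_step; last exact: ev_clear; rewrite /enc_instance; repeat ev_step.
  lia.
apply: ev_le; first by apply: ev_ifT; [exact: evr | apply: ev_tl; exact: evr].
lia.
Qed.

Lemma deepen_next l v t t' :
  search_runs l [:: set0] Nil t -> deepen_runs l.+1 v t' ->
  deepen_runs l v (t + 20 * n + 100 + t').
Proof.
move=> evs evd.
have evr : ev F (Cons (enc_instance G k) (enc_nat l))
    (ECall 9 (ECons (ECons (ECall 4 (EHd x1)) ENil) EArg)) Nil (t + 10 * n + 30).
  apply: ev_le.
    ev_step; last exact: evs.
    ev_step; last exact: ev_arg.
    ev_step; last exact: ev_nil.
    by ev_step; last exact: ev_clear; rewrite /enc_instance; repeat ev_step.
  lia.
apply: ev_le.
  apply: ev_ifF; first exact: evr.
  by ev_step; last exact: evd; repeat ev_step.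
lia.
Qed.

(** The trace of a failed search: a derivation is the explored part of the branching tree, and
    covers are counted by induction on it. *)
Inductive dry l : {set 'I_n} -> Prop :=
  | DryBig S : l < #|S| -> dry l S
  | DryNone S : step A G k S = Solved None -> dry l S
  | DryBranch S Ds : step A G k S = Branch Ds ->
      (forall D, D \in Ds -> dry l (S :|: D)) -> dry l S.

Lemma card_branch S Ds D :
  sub S -> step A G k S = Branch Ds -> D \in Ds ->
  0 < #|D| /\ #|S :|: D| = #|S| + #|D|.
Proof.
move=> subS E DDs; have := step_correct kn subS; rewrite E /= => -[_ H _].
have [D0 DS] := H D DDs; rewrite lt0n cards_eq0 D0; split=> //.
by rewrite cardsU setIC (eqP (_ : D :&: S == set0)) ?setI_eq0 // cards0 subn0.
Qed.

Local Open Scope ring_scope.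

Variables (R : realType) (rho : R).
Hypothesis rho1 : 1 <= rho.
Hypothesis weightP : forall S Ds, sub S -> step A G k S = Branch Ds ->
  \sum_(D <- Ds) rho ^- #|D| <= 1.

Let rho0 : 0 < rho. Proof. exact: lt_le_trans rho1. Qed.

(* Bounds the number of nodes with at most [l] vertices below one with [s]: the
   nodes with exactly [j] vertices have total weight at most [rho ^- s], and each
   of them has weight [rho ^- j]. *)
Definition potential (l s : nat) : R :=
  if (s <= l)%N then (l.+1 - s)%:R * rho ^+ (l - s) else 0.

Lemma potential_ge0 l s : 0 <= potential l s.
Proof.
by rewrite /potential; case: ifP => // _; rewrite mulr_ge0 // exprn_ge0 // ltW.
Qed.

(** A child with [d] new vertices has potential at most [(l - s) * rho ^ (l - s) * rho ^- d], so the
    children together stay below [(l - s) * rho ^ (l - s)]. The remaining [rho ^ (l - s)], which is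
    at least 1, pays for the node itself. *)
Lemma potential_branch l s Ds :
  (s <= l)%N -> (forall D, D \in Ds -> (0 < #|D|)%N) ->
  \sum_(D <- Ds) rho ^- #|D| <= 1 ->
  1 + \sum_(D <- Ds) potential l (s + #|D|) <= potential l s.
Proof.
move=> sl Ds0 w1.
have pw : 1 <= rho ^+ (l - s) by rewrite exprn_ege1.
have cge0 : 0 <= (l - s)%:R * rho ^+ (l - s) :> R.
  by rewrite mulr_ge0 // (le_trans ler01).
have le_sum : \sum_(D <- Ds) potential l (s + #|D|) <=
    (l - s)%:R * rho ^+ (l - s) * \sum_(D <- Ds) rho ^- #|D|.
  rewrite mulr_sumr !big_seq; apply: ler_sum => D /Ds0 D0; rewrite /potential.
  case: leqP => sD; last by rewrite mulr_ge0 // invr_ge0 exprn_ge0 // ltW.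
  rewrite -mulrA; apply: ler_pM => //; first by rewrite exprn_ge0 // ltW.
    by rewrite ler_nat; lia.
  have -> : (l - s)%N = (l - (s + #|D|) + #|D|)%N by lia.
  by rewrite exprD mulfK // expf_neq0 // gt_eqF.
rewrite /potential sl subSn // -[(l - s).+1]add1n natrD mulrDl mul1r lerD //.
by apply: le_trans le_sum _; rewrite ler_piMr.
Qed.

(** A visited node also pays one size test per child, since children that are too large have
    potential 0. *)
Definition visit_bound : R :=
  visit_cost%:R + (P + 2 * n + 5)%N%:R * test_cost%:R.

(* The pending covers [Ss] are processed within cost [b], whatever else is
   pending: a cover is found among their descendants, or there is none. *)
Definition searched l Ss (b : R) : Prop :=
  exists2 T, T%:R <= b &
    (exists2 C, C \in vertex_covers G k &
       forall st, search_runs l (Ss ++ st) (Cons Nil (enc_set C)) T) \/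
    ((forall S, S \in Ss -> dry l S) /\
     forall st v t, search_runs l st v t -> search_runs l (Ss ++ st) v (T + t)).

Lemma searched_nil l : searched l [::] 0.
Proof. by exists 0%N => //; right; split=> // st v t; rewrite add0n. Qed.

Lemma searched_cons l S Ss b b' :
  0 <= b' -> searched l [:: S] b -> searched l Ss b' -> searched l (S :: Ss) (b + b').
Proof.
move=> b'0 [T Tb [[C CG fC]|[dS nS]]] [T' Tb' H].
  by exists T; [rewrite (le_trans Tb) // lerDl | left; exists C => // st; apply: fC].
exists (T + T')%N; first by rewrite natrD lerD.
case: H => [[C CG fC]|[dSs nSs]].
  by left; exists C => // st; apply: nS; apply: fC.
right; split=> [S'|st v t evt].
  by rewrite inE => /orP[/eqP ->|/dSs //]; apply: dS; rewrite mem_head.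
by rewrite -addnA; apply: nS; apply: nSs.
Qed.

Lemma searched_all l (f : {set 'I_n} -> R) Ss :
  (forall S, S \in Ss -> 0 <= f S) ->
  (forall S, S \in Ss -> searched l [:: S] (f S)) ->
  searched l Ss (\sum_(S <- Ss) f S).
Proof.
elim: Ss => [|S Ss IH] f0 H; first by rewrite big_nil; apply: searched_nil.
rewrite big_cons; apply: searched_cons.
- by rewrite big_seq sumr_ge0 // => S' S'Ss; rewrite f0 // inE S'Ss orbT.
- by apply: H; rewrite mem_head.
- by apply: IH => S' S'Ss; [apply: f0 | apply: H]; rewrite inE S'Ss orbT.
Qed.

Lemma visit_bound_ge : visit_cost%:R <= visit_bound.
Proof. by rewrite lerDl mulr_ge0. Qed.

Lemma searched_node l S :
  sub S -> searched l [:: S] (test_cost%:R + visit_bound * potential l #|S|).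
Proof.
have vb0 : 0 <= visit_bound by apply: le_trans visit_bound_ge.
have [m] := ubnP (n - #|S|); elim: m S => // m IH S ltm subS.
have [lS|lS] := ltnP l #|S|.
  exists test_cost; first by rewrite lerDl mulr_ge0 // potential_ge0.
  right; split=> [S'|st v t]; last exact: search_big.
  by rewrite inE => /eqP ->; apply: DryBig.
have visit : visit_cost%:R <= test_cost%:R + visit_bound * potential l #|S|.
  rewrite (le_trans visit_bound_ge) // ler_wpDl // ler_peMr //.
  rewrite /potential lS mulr_ege1 ?exprn_ege1 //.
  by rewrite -[1]/(1%:R) ler_nat subn_gt0.
have := step_correct kn subS; case E : (step A G k S) => [[C|]|Ds] /= cor.
- exists visit_cost => //; left; exists C; first by case: cor.
  by move=> st; apply: search_some.
- exists visit_cost => //; right; split=> [S'|st v t]; last exact: search_none.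
  by rewrite inE => /eqP ->; apply: DryNone.
have DsP D : D \in Ds -> (0 < #|D|)%N /\ #|S :|: D| = (#|S| + #|D|)%N.
  exact: card_branch subS E.
have [||T Tb H] := @searched_all l
    (fun S' => test_cost%:R + visit_bound * potential l #|S'|)
    [seq S :|: D | D <- Ds].
- by move=> S' _; rewrite addr_ge0 // mulr_ge0 // potential_ge0.
- move=> _ /mapP[D DDs ->]; apply: IH; last exact: SubBranch subS E DDs.
  have [D0 ->] := DsP D DDs.
  have : (#|S :|: D| <= n)%N by rewrite -[n in (_ <= n)%N]card_ord max_card.
  by rewrite (DsP D DDs).2; move: ltm; lia.
exists (visit_cost + T)%N.
  rewrite natrD; apply: le_trans (lerD (lexx _) Tb) _.
  rewrite big_map big_split /= -mulr_sumr.
  have -> : \sum_(D <- Ds) potential l #|S :|: D| =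
      \sum_(D <- Ds) potential l (#|S| + #|D|).
    by rewrite !big_seq; apply: eq_bigr => D /DsP[_ ->].
  have pb := potential_branch lS (fun D DDs => (DsP D DDs).1) (weightP subS E).
  apply: le_trans (_ : visit_bound * (1 + \sum_(D <- Ds) potential l (#|S| + #|D|))
                       <= _).
    rewrite mulrDr mulr1 addrA lerD2r /visit_bound lerD2l.
    rewrite big_const_seq count_predT iter_addr_0 -[leLHS]mulr_natl ler_wpM2r // ler_nat.
    exact: size_branching subS E.
  by rewrite ler_wpDl // ler_wpM2l.
case: H => [[C CG fC]|[dSs nSs]].
  by left; exists C => // st; apply: search_branch subS lS E _.
right; split=> [S'|st v t evt].
  rewrite inE => /eqP ->; apply: DryBranch E _ => D DDs.
  by apply: dSs; apply/mapP; exists D.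
by rewrite -addnA; apply: search_branch subS lS E _; apply: nSs.
Qed.

(** * Covers missed by a failed search *)

Definition covers_above S := [set T in vertex_covers G k | S \subset T].

Lemma covers_above_big S : (k < #|S|)%N -> covers_above S = set0.
Proof.
move=> kS; apply/setP => T; rewrite !inE; apply/negbTE/negP.
by case/andP=> /andP[_ /eqP Tk] /subset_leq_card; rewrite Tk leqNgt kS.
Qed.

Lemma covers_above_branch S Ds :
  sub S -> step A G k S = Branch Ds ->
  covers_above S = \bigcup_(D <- Ds) covers_above (S :|: D).
Proof.
move=> subS E; have := step_correct kn subS; rewrite E /= => -[_ _ H].
apply/setP => T; rewrite bigcup_seq; apply/idP/bigcupP => [|[D DDs]].
  rewrite inE => /andP[TG ST]; have [D DDs DT] := H T TG ST.
  by exists D => //; rewrite inE TG subUset ST.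
by rewrite !inE subUset => /and3P[-> -> _].
Qed.

Lemma covers_above_none S :
  sub S -> step A G k S = Solved None -> covers_above S = set0.
Proof.
move=> subS E; have := step_correct kn subS; rewrite E /= => H.
apply/setP => T; rewrite inE in_set0; apply/negbTE/negP => /andP[TG].
by apply/negP; apply: H.
Qed.

Lemma dry_full l S : (k <= l)%N -> sub S -> dry l S -> covers_above S = set0.
Proof.
move=> kl subS dS; elim: dS subS => {}S.
- by move=> lS _; apply: covers_above_big; apply: leq_ltn_trans lS.
- by move=> E subS; apply: covers_above_none.
- move=> Ds E _ IH subS; rewrite (covers_above_branch subS E) big_seq.
  by apply: big1 => D DDs; apply: IH => //; apply: SubBranch subS E DDs.
Qed.

Local Notation z := (rho * k%:R / n%:R).

Hypothesis n0 : (0 < n)%N.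
Hypothesis z1 : z <= 1.

Let z0 : 0 <= z. Proof. by rewrite divr_ge0 // mulr_ge0 // ltW. Qed.

(** The factor [rho ^- #|S|] makes the bound inductive: at a branching, the bounds of the children
    add up to at most that of the parent by [weightP]. *)
Lemma dry_count l S :
  sub S -> dry l S ->
  #|covers_above S|%:R <= 'C(n, k)%:R * z ^+ l.+1 * rho ^- #|S|.
Proof.
move=> subS dS.
have b0 S' : 0 <= 'C(n, k)%:R * z ^+ l.+1 * rho ^- #|S'|.
  by rewrite !mulr_ge0 ?exprn_ge0 // invr_ge0 exprn_ge0 // ltW.
elim: dS subS => {}S.
- move=> lS _; have [kS|Sk] := ltnP k #|S|.
    by rewrite covers_above_big // cards0.
  have -> : 'C(n, k)%:R * z ^+ l.+1 * rho ^- #|S| =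
      'C(n, k)%:R * (z ^+ l.+1 * rho ^- #|S|) by rewrite mulrA.
  (* Here [z ^ #|S| * rho ^- #|S|] is [(k / n) ^ #|S|], and [z ^ #|S| <= z ^ l.+1] because
     [l < #|S|] and [z <= 1]. *)
  apply: le_trans (_ : 'C(n, k)%:R * (z ^+ #|S| * rho ^- #|S|) <= _); last first.
    apply: ler_wpM2l => //; apply: ler_wpM2r.
      by rewrite invr_ge0 exprn_ge0 // ltW.
    by apply: ler_wiXn2l.
  rewrite expr_div_n exprMn mulrAC [rho ^+ _ * _]mulrC mulfK; last first.
    by rewrite expf_neq0 // gt_eqF.
  rewrite mulrA ler_pdivlMr; last first.
    by rewrite exprn_gt0 // ltr0n.
  rewrite -!natrX -!natrM ler_nat.
  apply: leq_trans (bin_sub_ratio (_ : #|S| <= k <= n)%N); last by rewrite Sk.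
  rewrite leq_mul2r; apply/orP; right.
  rewrite -[n in 'C(n - _, _)]card_ord; apply: leq_trans (card_supersets Sk).
  apply/subset_leq_card/subsetP => T; rewrite !inE.
  by move=> /andP[/andP[_ ->] ->].
- by move=> E subS; rewrite (covers_above_none subS E) cards0.
- move=> Ds E _ IH subS; rewrite (covers_above_branch subS E).
  apply: le_trans (_ : \sum_(D <- Ds) #|covers_above (S :|: D)|%:R <= _).
    rewrite -natr_sum ler_nat; elim: (Ds) => [|D Ds' IHDs].
      by rewrite !big_nil cards0.
    by rewrite !big_cons (leq_trans (leq_card_setU _ _)) // leq_add2l.
  apply: le_trans (_ : 'C(n, k)%:R * z ^+ l.+1 * rho ^- #|S| *
      \sum_(D <- Ds) rho ^- #|D| <= _); last first.
    by rewrite ler_piMr // (weightP subS E).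
  rewrite mulr_sumr !big_seq; apply: ler_sum => D DDs.
  apply: le_trans (IH D DDs (SubBranch subS E DDs)) _.
  by rewrite (card_branch subS E DDs).2 exprD invfM -!mulrA.
Qed.

(** The factor 2 stems from [deepen_found], and [n.+1] bounds the factor [l.+1] in the potential of
    the root. *)
Definition deepen_bound : R :=
  2 * (test_cost%:R + visit_bound * n.+1%:R) + (20 * n + 120)%N%:R.

Lemma deepen_bound_ge l l' T :
  (l <= l' <= n)%N ->
  T%:R <= test_cost%:R + visit_bound * potential l #|set0 : {set 'I_n}| ->
  (2 * T + 20 * n + 120)%N%:R <= deepen_bound * rho ^+ l'.
Proof.
move=> /andP[ll' l'n] Tb; have rl' : 1 <= rho ^+ l' by rewrite exprn_ege1.
have vb0 : 0 <= visit_bound by apply: le_trans visit_bound_ge.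
rewrite /deepen_bound -addnA natrD natrM [leRHS]mulrDl lerD ?ler_peMr //.
rewrite -mulrA ler_wpM2l //; apply: le_trans Tb _; rewrite [leRHS]mulrDl lerD ?ler_peMr // -mulrA ler_wpM2l //.
rewrite cards0 /potential leq0n !subn0 ler_pM ?exprn_ge0 ?ler_nat ?ltnS //.
- exact: ltW.
- exact: leq_trans ll' l'n.
- by rewrite ler_weXn2l.
Qed.

(** The invariant is [eps <= z ^ l]: a failure at level [l] yields [eps <= z ^ l.+1] by [dry_count].
    Each of the at most [j.+1] rounds is charged at the rate [rho ^ l'] of the last one. *)
Lemma deepen_spec (eps : R) j l :
  0 < eps -> eps * 'C(n, k)%:R <= #|vertex_covers G k|%:R ->
  (l + j = k)%N -> eps <= z ^+ l ->
  exists l' C T, [/\ eps <= z ^+ l', (l <= l' <= k)%N, C \in vertex_covers G k,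
    deepen_runs l (enc_set C) T & T%:R <= j.+1%:R * deepen_bound * rho ^+ l'].
Proof.
move=> eps0 covG.
have covers0 : covers_above set0 = vertex_covers G k.
  by apply/setP => T; rewrite inE sub0set andbT.
have vb0 : 0 <= visit_bound by apply: le_trans visit_bound_ge.
have db0 l' : 0 <= deepen_bound * rho ^+ l'.
  have ? : 0 <= rho ^+ l' by rewrite exprn_ge0 // ltW.
  apply: mulr_ge0 => //; apply: addr_ge0 => //; apply: mulr_ge0 => //.
  by apply: addr_ge0 => //; apply: mulr_ge0.
elim: j l => [|j IH] l ljk epsl;
  have [T Tb [[C CG fC]|[dS nS]]] := searched_node l (SubRoot (step A) G k).
- exists l, C, (2 * T + 20 * n + 120)%N; split=> //.
  + by rewrite leqnn -ljk leq_addr.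
  + by apply: ev_le (deepen_found (fC [::])) _; lia.
  + by rewrite mul1r; apply: deepen_bound_ge Tb; rewrite leqnn; lia.
(* At level [k] a failure would mean that there is no cover at all, against [0 < eps]. *)
- have := covG; rewrite -covers0 (@dry_full l) ?cards0 //; last 3 first.
  + by rewrite -ljk addn0.
  + exact: SubRoot.
  + by apply: dS; rewrite mem_head.
  by rewrite leNgt mulr_gt0 // ltr0n bin_gt0.
- exists l, C, (2 * T + 20 * n + 120)%N; split=> //.
  + by rewrite leqnn -ljk leq_addr.
  + by apply: ev_le (deepen_found (fC [::])) _; lia.
  + apply: le_trans (deepen_bound_ge (l' := l) _ Tb) _; first by rewrite leqnn; lia.
    by rewrite -mulrA ler_peMl // ler1n.
- have [||l' [C [T' [epsl' ll' CG rT' T'b]]]] := IH l.+1.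
  + by rewrite -ljk addSnnS.
  + have := dry_count (SubRoot (step A) G k) (dS _ (mem_head _ _)).
    rewrite covers0 cards0 expr0 invr1 mulr1 mulrC => /(le_trans covG).
    by rewrite ler_pM2r // ltr0n bin_gt0.
  exists l', C, (T + 10 + 20 * n + 100 + T')%N; split=> //.
  + by case/andP: ll' => /ltnW -> ->.
  + by apply: deepen_next rT'; apply: nS; apply: search_nil.
  + have -> : j.+2%:R = j.+1%:R + 1 :> R by rewrite -[j.+2]addn1 natrD.
    rewrite natrD addrC -mulrA [leRHS]mulrDl mul1r mulrA lerD //.
    apply: le_trans (deepen_bound_ge (l := l) (l' := l') _ Tb).
      by rewrite ler_nat; lia.
    by case/andP: ll' => ll' l'k; rewrite (ltnW ll') (leq_trans l'k).
Qed.

End Instance.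

End Search.

Local Open Scope ring_scope.

(** With [q = n / (rho * k) > 1] the hypothesis reads [eps <= q ^- l], that is,
    [l * ln q <= - ln eps]; multiply by [ln rho / ln q]. *)
Lemma expr_le_powR (R : realType) (rho eps : R) (n k l : nat) :
  1 <= rho -> 0 < eps -> k%:R < n%:R / rho ->
  eps <= (rho * k%:R / n%:R) ^+ l ->
  rho ^+ l <= eps `^ (- (log2 rho / log2 (n%:R / (rho * k%:R)))).
Proof.
move=> rho1 eps0 kn epsl; have rho0 : 0 < rho by apply: lt_le_trans rho1.
(* For [k = 0] the exponent is 0 by convention, and [eps <= 0 ^ l] forces [l = 0]. *)
have [k0|k0] := posnP k.
  have Z : rho * k%:R = 0 by rewrite k0 mulr0.
  move: epsl; rewrite Z invr0 mulr0 mul0r /log2 [ln 0]ln0 // mul0r invr0 mulr0.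
  rewrite oppr0 powRr0; case: l => [|l]; first by rewrite expr0.
  by rewrite [0 ^+ _]exprS mul0r leNgt eps0.
have n0 : (0 < n)%N by case: (n) kn => //; rewrite mul0r ltrn0.
have kR : 0 < k%:R :> R by rewrite ltr0n.
have nR : 0 < n%:R :> R by rewrite ltr0n.
set q := n%:R / (rho * k%:R).
have q1 : 1 < q by rewrite ltr_pdivlMr ?mulr_gt0 // mul1r mulrC -ltr_pdivlMr.
have q0 : 0 < q by apply: lt_trans q1.
have lnq : 0 < ln q by rewrite ln_gt0.
have Ez : rho * k%:R / n%:R = q^-1 by rewrite invf_div.
have lneps : ln eps <= - (l%:R * ln q).
  rewrite Ez exprVn -(@ler_ln _ eps) ?posrE ?invr_gt0 ?exprn_gt0 // in epsl.
  by rewrite lnV ?posrE ?exprn_gt0 // lnXn // -mulr_natl in epsl.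
have Elog : log2 rho / log2 q = ln rho / ln q.
  have ln2 : ln 2 != 0 :> R by rewrite gt_eqF // ln_gt0 // ltr1n.
  by rewrite /log2 invfM invrK mulrACA mulVf // mulr1.
rewrite Elog /powR gt_eqF // -[rho in rho ^+ l]lnK ?posrE // -expRM_natl ler_expR.
have -> : l%:R * ln rho = ln rho / ln q * (l%:R * ln q).
  by rewrite mulrCA -mulrA mulVf ?mulr1 // gt_eqF.
rewrite mulNr -mulrN ler_wpM2l ?divr_ge0 ?ln_ge0 ?(ltW lnq) ?(ltW q1) //.
by rewrite lerNr.
Qed.

Lemma finds_cover_of_weights (R : realType) (A : branching_algorithm) (rho : R) :
  1 <= rho ->
  (forall ds, branching_vector A ds -> \sum_(d <- ds) rho ^- d <= 1) ->
  finds_cover_among_many rho.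
Proof.
move=> rho1 weight; have rho0 : 0 < rho by apply: lt_le_trans rho1.
have [pA HA] := step_polytime A.
pose P n := pA.[n]; pose t n := test_cost n; pose v n := visit_cost n (P n).
(* This is [deepen_bound] as a natural number. In the polynomial below, [n.+1] accounts for the
   [k.+1] rounds and 10 for the main expression. *)
pose W n := (2 * (t n + (v n + (P n + 2 * n + 5) * t n) * n.+1) +
  (20 * n + 120))%N.
have [p Hp] : poly_bounded (fun n => n.+1 * W n + 10)%N.
  have pP : poly_bounded P by exists pA.
  have pX := poly_boundedX.
  by rewrite /W /v /visit_cost /t /test_cost; auto 30 with polyb.
exists (search_code A), p => n G k eps kn eps0 covG.
have n0 : (0 < n)%N.
  by case: (n) kn => //; rewrite mul0r ltrn0.
have nR : 0 < n%:R :> R by rewrite ltr0n.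
have ltkn : (k < n)%N.
  rewrite -(ltr_nat R); apply: lt_le_trans kn _.
  by rewrite ler_pdivrMr // ler_peMr.
have z1 : rho * k%:R / n%:R <= 1.
  by rewrite ler_pdivrMr // mul1r mulrC -ler_pdivlMr // ltW.
have kn' := ltnW ltkn.
have stepP S : subproblem (step A) G k S -> exists2 t, (t <= P n)%N &
    runs (step_code A) (enc_subproblem G k S) (enc_outcome (step A G k S)) t.
  exact: HA.
have weightP S Ds : subproblem (step A) G k S -> step A G k S = Branch Ds ->
    \sum_(D <- Ds) rho ^- #|D| <= 1.
  move=> subS E; have := weight [seq #|D| | D : {set 'I_n} <- Ds].
  by rewrite big_map; apply; exists n, G, k, S, Ds.
(* The invariant holds at level 0, as there are only ['C(n, k)] sets of size [k]. *)
have eps1 : eps <= (rho * k%:R / n%:R) ^+ 0.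
  have b0 : 0 < 'C(n, k)%:R :> R by rewrite ltr0n bin_gt0.
  rewrite expr0 -(ler_pM2r b0) mul1r; apply: le_trans covG _; rewrite ler_nat.
  rewrite -[n in 'C(n, _)]card_ord -card_draws.
  by apply/subset_leq_card/subsetP => T; rewrite !inE => /andP[].
have [l [C [T [epsl _ CG evC Tb]]]] :=
  deepen_spec kn' stepP rho1 weightP n0 z1 eps0 covG (add0n k) eps1.
have [s sT evs] : ev (set_lib ++ search_funs A) (enc_instance G k)
    (ECall 11 (ECons EArg ENil)) (enc_set C) (T + 10).
  apply: ev_le; first by ev_step; last exact: evC; repeat ev_step.
  lia.
exists C, s; split=> //.
apply: le_trans (_ : (p.[n])%:R * rho ^+ l <= _); last first.
  by rewrite ler_wpM2l // expr_le_powR.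
apply: le_trans (_ : (n.+1 * W n + 10)%N%:R * rho ^+ l <= _); last first.
  by rewrite ler_wpM2r ?exprn_ge0 ?ler_nat // ltW.
apply: le_trans (_ : (T + 10)%N%:R <= _); first by rewrite ler_nat.
have rl : 1 <= rho ^+ l by rewrite exprn_ege1.
have WE : deepen_bound n (P n) R = (W n)%:R.
  rewrite [RHS]natrD; congr (_ + _); rewrite natrM; congr (_ * _).
  rewrite natrD; congr (_ + _); rewrite natrM; congr (_ * _).
  by rewrite natrD natrM.
rewrite natrD [(_ + 10)%N%:R]natrD [leRHS]mulrDl lerD ?ler_peMr //.
apply: le_trans Tb _; rewrite WE ler_wpM2r ?(le_trans ler01) // natrM.
by rewrite ler_wpM2r // ler_nat.
Qed.

(** * Branching numbers *)

Lemma branching_vector_pos A ds :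
  branching_vector A ds -> ds != [::] /\ all (fun d => 0 < d)%N ds.
Proof.
move=> [n [G [k [S [Ds [kn subS E ->]]]]]].
have := step_correct kn subS; rewrite E /= => -[Ds0 H _]; split.
  by case: (Ds) Ds0.
by apply/allP => _ /mapP[D /H[D0 _] ->]; rewrite lt0n cards_eq0.
Qed.

Lemma sum_expV_lt (R : realType) (ds : seq nat) (x y : R) :
  ds != [::] -> all (fun d => 0 < d)%N ds -> 0 < x -> x < y ->
  \sum_(d <- ds) y ^- d < \sum_(d <- ds) x ^- d.
Proof.
case: ds => // d ds _ /= /andP[d0 _] x0 xy; have y0 := lt_trans x0 xy.
rewrite !big_cons ltr_leD //.
  by rewrite ltf_pV2 ?posrE ?exprn_gt0 // ltrXn2r // -?lt0n // ltW.
apply: ler_sum => e _; rewrite lef_pV2 ?posrE ?exprn_gt0 //.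
by rewrite lerXn2r ?nnegrE // ltW.
Qed.

(** At 1 the sum is the length of [ds], hence at least 1, and at any smaller point it is larger
    still. *)
Lemma vector_value_ge1 (R : realType) ds (x : R) :
  ds != [::] -> all (fun d => 0 < d)%N ds -> vector_value ds x -> 1 <= x.
Proof.
move=> ds0 dsP [[x0 sumx] _]; rewrite leNgt; apply/negP => x1.
have := sum_expV_lt ds0 dsP x0 x1; rewrite sumx.
under eq_bigr do rewrite expr1n invr1.
case: ds ds0 {dsP sumx} => // d ds _.
by rewrite big_cons ltNge lerDl sumr_ge0.
Qed.

(* If the sum exceeded 1, the intermediate value theorem would provide a solution
   above [rho], which by monotonicity is the only one. *)
Lemma sum_le1_of_value (R : realType) ds (rho : R) :
  ds != [::] -> all (fun d => 0 < d)%N ds -> 0 < rho ->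
  (forall x, vector_value ds x -> x <= rho) -> \sum_(d <- ds) rho ^- d <= 1.
Proof.
move=> ds0 dsP rho0 max_rho; rewrite leNgt; apply/negP => gt1.
(* In the reciprocal variable the equation is polynomial, and [p] changes sign between 0 and
   [rho^-1]. *)
pose p : {poly R} := \sum_(d <- ds) 'X^d - 1.
have pE x : p.[x] = \sum_(d <- ds) x ^+ d - 1.
  rewrite hornerD hornerN hornerC horner_sum; congr (_ - _).
  by apply: eq_bigr => d _; rewrite hornerXn.
have p0 : p.[0] = -1.
  rewrite pE big_seq big1 ?sub0r // => d /(allP dsP) d0.
  by rewrite expr0n eqn0Ngt d0.
have [||z /andP[z0 zrho] /rootP pz] := @poly_ivt _ p 0 rho^-1.
- by rewrite invr_ge0 ltW.
- rewrite p0 lerN10 /= pE subr_ge0; under eq_bigr do rewrite exprVn.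
  exact: ltW.
have {}z0 : 0 < z.
  rewrite lt_neqAle z0 andbT; apply/eqP => Ez; move: pz; rewrite -Ez p0.
  by apply/eqP; rewrite oppr_eq0 oner_eq0.
have sumz : \sum_(d <- ds) z^-1 ^- d = 1.
  under eq_bigr do rewrite -exprVn invrK.
  by apply/eqP; rewrite -subr_eq0 -pE pz.
have zV0 : 0 < z^-1 by rewrite invr_gt0.
have value : vector_value ds z^-1.
  split=> // y [y0 sumy]; rewrite leNgt; apply/negP => yz.
  by have := sum_expV_lt ds0 dsP y0 yz; rewrite sumy sumz ltxx.
have Ez : z = rho^-1.
  apply/eqP; rewrite eq_le zrho -[z in _ <= z]invrK lef_pV2 ?posrE //.
  exact: max_rho.
by move: gt1; rewrite -[rho]invrK -Ez sumz ltxx.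
Qed.

Lemma branching_number_weights (R : realType) A (rho : R) :
  branching_number A rho ->
  1 <= rho /\
  (forall ds, branching_vector A ds -> \sum_(d <- ds) rho ^- d <= 1).
Proof.
move=> [[ds vec val] max_rho].
have [ds0 dsP] := branching_vector_pos vec.
have rho1 := vector_value_ge1 ds0 dsP val; split=> // ds' vec'.
have [ds'0 ds'P] := branching_vector_pos vec'.
apply: sum_le1_of_value => // [|x]; first exact: lt_le_trans rho1.
exact: max_rho.
Qed.

Lemma branch3_weights (R : realType) ds :
  branching_vector branch3 ds ->
  \sum_(d <- ds) (916%:R / 625%:R : R) ^- d <= 1.
Proof.
move=> [n [G [k [S [Ds [_ _ /branch3_vector[d d2 ->] ->]]]]]].
rewrite !big_cons big_nil addr0 -!exprVn invf_div.
(* Since [625 / 916 < 1], degree 3 is the worst case. *)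
apply: le_trans (_ : (625 / 916) ^+ 1 + (625 / 916) ^+ 3 <= _).
  by rewrite lerD2l ler_wiXn2l //; lra.
lra.
Qed.

Theorem theorem6 (R : realType) :
  (forall (A : branching_algorithm) (rho : R),
     branching_number A rho -> finds_cover_among_many rho) /\
  finds_cover_among_many (916%:R / 625%:R : R) (* 916 / 625 = 1.4656 *).
Proof.
split=> [A rho /branching_number_weights[rho1 weights]|].
  exact: finds_cover_of_weights rho1 weights.
apply: (@finds_cover_of_weights _ branch3); first by lra.
exact: branch3_weights.
Qed.
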